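(* Let $a>b>0$ and consider the magic billiard with flipping over the short axis in the table bounded by the ellipse $\mathcal{E}:\ \frac{x^2}{a}+\frac{y^2}{b}=1$. Consider a trajectory of this billiard with caustic $\mathcal{C}_\beta$. Let $n$ be a positive integer. The trajectory is $n$-periodic if and only if $n$ is even and the following equivalent conditions are true: (i) $$\left|\begin{array}{cccc} B_3 & B_4 & \dots & B_{n/2+1}\\ B_4 & B_5 & \dots & B_{n/2+2}\\ \dots\\ B_{n/2+1} & B_{n/2+2} & \dots & B_{n-1}\end{array}\right|=0,$$ where $\sqrt{(a-x)(b-x)(\beta-x)}=B_0+B_1x+B_2x^2+\dots$ is the Taylor expansion around $x=0$; (ii) writing $n=2m$, there exist real polynomials $p_m$, $q_{m-2}$ of degrees $m$, $m-2$ respectively such that $$p_m^2(s)-s\left(s-\frac1a\right)\left(s-\frac1b\right)\left(s-\frac1\beta\right)q_{m-2}^2(s)=1.$$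
   Context: Confocal family: $\mathcal{C}_\lambda:\ \frac{x^2}{a-\lambda}+\frac{y^2}{b-\lambda}=1$, so $\mathcal{E}=\mathcal{C}_0$; $\mathcal{C}_\lambda$ is an ellipse for $\lambda<b$ and a hyperbola for $b<\lambda<a$. Magic billiard with flipping over the short axis: let $D$ be the closed domain bounded by $\mathcal{E}$, and let $\varphi$ be the reflection of the plane with respect to the shorter axis of $\mathcal{E}$, $\varphi(x,y)=(-x,y)$. A particle moves with unit speed along straight segments inside $D$. When it hits $\mathcal{E}$ at a point $A$ with velocity $\vec v$, it continues from the point $\varphi(A)$ with velocity $\varphi^*(\vec v)=d\varphi(\rho_A(\vec v))$, where $\rho_A$ is the usual billiard reflection (reflection of vectors with respect to the tangent line to $\mathcal{E}$ at $A$). Caustic: each trajectory has a unique conic $\mathcal{C}_\beta$ of the confocal family such that the lines containing the segments of the trajectory are all tangent to $\mathcal{C}_\beta$; it is called the caustic of the trajectory. The caustic is nondegenerate, i.e. $\beta\in(0,b)\cup(b,a)$. $n$-periodic: after $n$ consecutive hits at the boundary the particle returns to its initial position and velocity ($n$ is not required to be the minimal such number). The determinant is of a Hankel matrix of size $n/2-1$; an empty ($0\times0$) determinant equals $1$, so the condition then fails. A polynomial of negative degree is understood to be the zero polynomial. The branch of the square root is the one positive at $x=0$. *)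

(* Defs.v *)
From HB Require Import structures.
From mathcomp Require Import all_boot all_order all_algebra.
From mathcomp Require Import all_classical all_reals all_analysis.
Import Order.TTheory GRing.Theory Num.Theory.
Import numFieldNormedType.Exports.
Set Implicit Arguments.
Unset Strict Implicit.
Unset Printing Implicit Defensive.
Local Open Scope ring_scope.

Definition confocal (R : realType) (a b lambda : R) (P : R * R) : Prop :=
  P.1 ^+ 2 / (a - lambda) + P.2 ^+ 2 / (b - lambda) = 1.

Definition boundary (R : realType) (a b : R) (P : R * R) : Prop :=
  confocal a b 0 P.

Definition table (R : realType) (a b : R) (P : R * R) : Prop :=
  P.1 ^+ 2 / a + P.2 ^+ 2 / b <= 1.

Definition dot (R : realType) (u v : R * R) : R := u.1 * v.1 + u.2 * v.2.

Definition move (R : realType) (P v : R * R) (t : R) : R * R :=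
  (P.1 + t * v.1, P.2 + t * v.2).

(* Since a > b, the shorter axis lies on x = 0.  The map is linear, so it is
   also its own differential. *)
Definition flip (R : realType) (P : R * R) : R * R := (- P.1, P.2).

Definition normal_at (R : realType) (a b : R) (A : R * R) : R * R :=
  (A.1 / a, A.2 / b).

Definition reflect_at (R : realType) (a b : R) (A v : R * R) : R * R :=
  move v (normal_at a b A)
    (- (2 * dot v (normal_at a b A) / dot (normal_at a b A) (normal_at a b A))).

(* P k and v k are the position and velocity just after the k-th hit (just
   after the jump); tau k is the time of flight until the next hit.  The
   initial position P 0 may be an interior point of the table.  As P k is in
   the table and tau k > 0, the point move (P k) (v k) (tau k) is the first
   point of the boundary met by the particle after leaving P k. *)
Definition magic_trajectory (R : realType) (a b : R)
    (P v : nat -> R * R) (tau : nat -> R) : Prop :=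
  [/\ table a b (P 0%N),
      dot (v 0%N) (v 0%N) = 1
    & forall k : nat,
        let A := move (P k) (v k) (tau k) in
        [/\ 0 < tau k,
            boundary a b A,
            P k.+1 = flip A
          & v k.+1 = flip (reflect_at a b A (v k))]].

(* Between its n-th and (n+1)-st hits the particle is at its initial position
   with its initial velocity.  When P 0 is on the boundary, s has to be 0 and
   this says (P n, v n) = (P 0, v 0). *)
Definition n_periodic (R : realType) (P v : nat -> R * R) (tau : nat -> R)
    (n : nat) : Prop :=
  v n = v 0%N /\
  exists s : R, 0 <= s < tau n /\ P 0%N = move (P n) (v n) s.

(* The line P + R v is the tangent to the projective closure of the conic at
   the point (X : Y : Z).  Points at infinity (Z = 0) are needed because a
   segment passing through the center of the ellipse lies on an asymptote of
   its caustic. *)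
Definition tangent_to_confocal (R : realType) (a b lambda : R)
    (P v : R * R) : Prop :=
  exists X Y Z : R,
    [/\ (X, Y, Z) <> (0, 0, 0),
        X ^+ 2 / (a - lambda) + Y ^+ 2 / (b - lambda) = Z ^+ 2
      & forall t : R,
          X * (move P v t).1 / (a - lambda) +
          Y * (move P v t).2 / (b - lambda) = Z].

Definition has_caustic (R : realType) (a b : R) (P v : nat -> R * R)
    (beta : R) : Prop :=
  forall k : nat, tangent_to_confocal a b beta (P k) (v k).

Definition taylor_coef (R : realType) (f : R -> R) (k : nat) : R :=
  derive1n k f 0 / k`!%:R.

Definition sqrt_coef (R : realType) (a b beta : R) (k : nat) : R :=
  taylor_coef (fun x : R => Num.sqrt ((a - x) * (b - x) * (beta - x))) k.

Definition cayley_condition (R : realType) (a b beta : R) (m : nat) : Prop :=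
  \det (\matrix_(i < m.-1, j < m.-1) sqrt_coef a b beta (i + j + 3)%N) = 0.

(* The size of a polynomial is its degree plus one: p has degree m and q has
   degree m - 2, with q = 0 when m = 1. *)
Definition pell_condition (R : realType) (a b beta : R) (m : nat) : Prop :=
  exists p q : {poly R},
    [/\ size p = m.+1,
        size q = m.-1
      & p ^+ 2 - 'X * ('X - (a^-1)%:P) * ('X - (b^-1)%:P) *
          ('X - (beta^-1)%:P) * q ^+ 2 = 1].

(* Main.v *)
(* In the parameter s = 1/x dual to the confocal parameter x, the 2x2 matrix
   [lax] of a state (P, v), P on the ellipse, is conjugated by a shear linear
   in s at every reflection and by a constant shear along every free flight,
   and its square is the scalar a b beta Q(s) with
   Q = s (s - 1/a) (s - 1/b) (s - 1/beta).  The product M of the shears over n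
   hits is unimodular; M(1/a) and M(1/b) move the coordinates (x, x') and
   (y, y') of the state, up to the signs due to the flips.

   If the trajectory closes up, then M commutes with [lax], hence
   M = p + q lax with p^2 - a b beta Q q^2 = 1, deg p = n, p(0) = p(1/b) = 1
   and p(1/a) = (-1)^n.  Distributing the roots of Q over the coprime factors
   p - 1 and p + 1 excludes odd n and gives, for n = 2 m, p = 2 p_m^2 - 1 with
   p_m a solution of the Pell equation of degree m.  Conversely, such a p_m
   yields N = (2 p_m^2 - 1) + q lax, and comparing leading coefficients the
   flights and reflections of the trajectory split off N one by one, so N = M
   and the trajectory closes up.

   The Pell equation is a Pade condition at x = 0 for the square root, that is
   the vanishing of the Hankel determinant. *)

Require Import Defs.
From HB Require Import structures.
From mathcomp Require Import all_boot all_order all_algebra.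
From mathcomp Require Import all_classical all_reals all_analysis.
From mathcomp Require Import separable ring lra zify.
Import Order.TTheory GRing.Theory Num.Theory.
Import numFieldNormedType.Exports.
Local Open Scope ring_scope.

(** * Taylor coefficients of the square root of a polynomial *)

Section TaylorTower.
Variable R : realType.
Implicit Types (f : R -> R) (c : nat -> R -> R) (e x : R) (g : {poly R}).

(** [c k x] stands for the [k]-th derivative at [x] divided by [k!]. With this normalisation
    Leibniz's rule is a plain Cauchy product. *)
Definition taylor_tower e c :=
  forall k x, `|x| < e -> is_derive x 1 (c k) (k.+1%:R * c k.+1 x).

Lemma taylor_tower_derive1n e c f :
  (forall x, `|x| < e -> c 0%N x = f x) -> taylor_tower e c ->
  forall k x, `|x| < e -> derive1n k f x = k`!%:R * c k x.
Proof.
move=> c0 cD; elim=> [|k IH] x xe; first by rewrite mul1r c0.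
rewrite derive1nS derive1E.
have nxe : \forall y \near x, `|y| < e.
  have [d /= d0 dP] : exists2 d : R, 0 < d & forall y, `|x - y| < d -> `|y| < e.
    exists (e - `|x|) => [|y yd]; first by rewrite subr_gt0.
    by have := ler_normB x (x - y); rewrite subKr; lra.
  by apply/nbhs_ballP; exists d => // y; apply: dP.
rewrite (@near_eq_derive _ _ _ _ (k`!%:R *: c k)) //; last first.
  by near=> y; rewrite IH//; near: y.
have cDx := cD k x xe.
rewrite derive_val factS natrM.
by rewrite /GRing.scale /=; ring.
Unshelve. all: by end_near.
Qed.

Lemma taylor_tower_conv e c : taylor_tower e c ->
  taylor_tower e (fun n x => \sum_(i < n.+1) c i x * c (n - i)%N x).
Proof.
move=> cD n x xe.
have -> : (fun y => \sum_(i < n.+1) c i y * c (n - i)%N y) =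
          \sum_(i < n.+1) (c i * c (n - i)%N).
  by apply/funext => y; rewrite fct_sumE.
have cDx k := cD k x xe.
apply: is_derive_eq.
(* Raising the second index gives term [i] the weight [n.+1 - i]; raising the first gives it, after
   a shift, the weight [i]. The weights add up to [n.+1]. *)
transitivity (\sum_(i < n.+1) ((n.+1 - i)%:R * (c i x * c (n.+1 - i)%N x)) +
   \sum_(i < n.+1) (i.+1%:R * (c i.+1 x * c (n.+1 - i.+1)%N x))).
  rewrite -big_split; apply: eq_bigr => i _ /=.
  by rewrite /GRing.scale /= subSS subSn ?(ltnSE (ltn_ord i))//; ring.
transitivity (\sum_(i < n.+2) ((n.+1 - i)%:R * (c i x * c (n.+1 - i)%N x)) +
   \sum_(i < n.+2) (i%:R * (c i x * c (n.+1 - i)%N x))).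
  congr +%R; first by rewrite [RHS]big_ord_recr /= subnn mul0r addr0.
  by rewrite [RHS]big_ord_recl /= mul0r add0r.
rewrite -big_split /= mulr_sumr; apply: eq_bigr => i _.
by rewrite -mulrDl -natrD subnK // -ltnS.
Qed.

Lemma taylor_tower_poly e g : taylor_tower e (fun k => horner g^`N(k)).
Proof.
move=> k x _; apply: is_derive_eq; rewrite -[LHS]/((g^`N(k))^`().[x]).
have H : (g^`N(k))^`() *+ k`! = (g^`N(k.+1) *+ k.+1) *+ k`!.
  by rewrite -derivMn -nderivn_def -derivnS nderivn_def -mulrnA factS.
have : ((g^`N(k))^`() *+ k`!).[x] = (g^`N(k.+1) *+ k.+1 *+ k`!).[x] by rewrite H.
rewrite !hornerMn -[LHS]mulr_natl -[RHS]mulr_natl => /mulfI ->.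
  by rewrite mulr_natl.
by rewrite pnatr_eq0 -lt0n fact_gt0.
Qed.

Lemma sqrt_taylor_tower e g : (forall x, `|x| < e -> 0 < g.[x]) ->
  exists2 c, c 0%N = (fun x => Num.sqrt g.[x]) & taylor_tower e c.
Proof.
move=> gpos.
(* Differentiating [r k * sqrt g / g ^ k] gives [(r' g + (1/2 - k) r g') sqrt g / g ^ k.+1]; the
   factor [k.+1] of the tower is divided out. *)
pose r := fix r k : {poly R} := if k is j.+1 then
  (j.+1%:R^-1)%:P * ((r j)^`() * g + (2^-1 - j%:R)%:P * (r j * g^`())) else 1.
exists (fun k x => (r k).[x] * Num.sqrt g.[x] / g.[x] ^+ k).
  by apply/funext => x; rewrite /= hornerC expr0 divr1 mul1r.
move=> k x xe; have gx := gpos x xe.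
have sD : is_derive x 1 (Num.sqrt \o horner g)
   ((2 * Num.sqrt g.[x])^-1 * g^`().[x]).
  have sqD := is_derive1_sqrt gx; exact: is_derive1_comp.
have vD : is_derive x 1 (fun y => (g.[y] ^+ k)^-1)
   (- (g.[x] ^+ k) ^- 2 *: (k%:R * g.[x] ^+ k.-1 * g^`().[x])).
  apply: is_deriveV; first by rewrite expf_neq0 // gt_eqF.
  have -> : (fun y => g.[y] ^+ k) = horner g ^+ k by rewrite exprfctE.
  apply: is_derive_eq. by [].
rewrite -[X in is_derive _ _ X]/((horner (r k) * (Num.sqrt \o horner g)) * (fun y => (g.[y] ^+ k)^-1)).
apply: is_derive_eq.
rewrite -[(horner (r k) * _) x]/((r k).[x] * Num.sqrt g.[x]) /GRing.scale /= !hornerE /=.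
have s0 : Num.sqrt g.[x] != 0 by rewrite gt_eqF // sqrtr_gt0.
have g0 : g.[x] != 0 by rewrite gt_eqF.
have [s sE] : exists s, s = Num.sqrt g.[x] by exists (Num.sqrt g.[x]).
have gE : g.[x] = s ^+ 2 by rewrite sE sqr_sqrtr // ltW.
have kE z : z != 0 -> k%:R * z ^+ k.-1 = k%:R * z ^+ k / z :> R.
  by case: (k) => [|j] z0; rewrite ?mul0r // exprSr mulrA mulfK.
have k0 : (k.+1%:R : R) != 0 by rewrite pnatr_eq0.
have gk0 : g.[x] ^+ k != 0 by rewrite expf_neq0.
rewrite -sE in s0 *; rewrite -[_ * k%:R * _]mulrA kE // [_ ^+ k.+1]exprS; move: gk0 g0.
move: (g.[x] ^+ k) => z z0 g0; rewrite gE in g0 *.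
by field; rewrite nat1r k0 z0 s0.
Qed.

(** The Cauchy square of the tower of [sqrt g] is a tower starting with [g], and so is the tower of
    normalised derivatives of [g]. Both compute the derivatives of [g] at 0. *)
Lemma taylor_coef_sqrt_conv e g : 0 < e -> (forall x, `|x| < e -> 0 < g.[x]) ->
  let B := taylor_coef (fun x => Num.sqrt g.[x]) in
  forall n, \sum_(i < n.+1) B i * B (n - i)%N = g`_n.
Proof.
move=> e0 gpos /= n; have z0 : `|0 : R| < e by rewrite normr0.
have [c c0 cD] := sqrt_taylor_tower _ _ gpos.
have BE k : taylor_coef (fun x => Num.sqrt g.[x]) k = c k 0.
  rewrite /taylor_coef (taylor_tower_derive1n e c) // => [|x _]; last by rewrite c0.
  by rewrite mulrAC divff ?mul1r // pnatr_eq0 -lt0n fact_gt0.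
have k0 : (n`!%:R : R) != 0 by rewrite pnatr_eq0 -lt0n fact_gt0.
transitivity (\sum_(i < n.+1) c i 0 * c (n - i)%N 0); first by apply: eq_bigr => i _; rewrite !BE.
apply: (mulfI k0).
rewrite -(taylor_tower_derive1n e (fun n x => \sum_(i < n.+1) c i x * c (n - i)%N x) (horner g)) //; last 2 first.
- by move=> x xe; rewrite big_ord_recl big_ord0 addr0 c0 -expr2 sqr_sqrtr // ltW // gpos.
- exact: taylor_tower_conv.
rewrite (taylor_tower_derive1n e _ _ _ (taylor_tower_poly e g)) // => [|x _]; last by rewrite nderivn0.
by rewrite horner_coef0 coef_nderivn addn0 binn.
Qed.

End TaylorTower.

(** * Hankel determinants and Pell's equation *)

Section Reversal.
Variable F : fieldType.
Implicit Types (p q : {poly F}) (m n k : nat).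

(** This is [x^n p(1/x)] for a nominal degree [n], which may exceed the degree of [p]: reversal is
    then linear, and nominal degrees add up under products. *)
Definition rev_poly n p : {poly F} := \sum_(i < n.+1) p`_i *: 'X^(n - i).

Lemma rev_polyD n p q : rev_poly n (p + q) = rev_poly n p + rev_poly n q.
Proof. by rewrite -big_split; apply: eq_bigr => i _; rewrite coefD scalerDl. Qed.

Lemma rev_polyZ n c p : rev_poly n (c *: p) = c *: rev_poly n p.
Proof. by rewrite scaler_sumr; apply: eq_bigr => i _; rewrite coefZ scalerA. Qed.

Lemma rev_polyB n p q : rev_poly n (p - q) = rev_poly n p - rev_poly n q.
Proof. by rewrite rev_polyD -scaleN1r rev_polyZ scaleN1r. Qed.

Lemma rev_poly_sum n I (r : seq I) (E : I -> {poly F}) :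
  rev_poly n (\sum_(i <- r) E i) = \sum_(i <- r) rev_poly n (E i).
Proof.
apply: (big_morph _ (rev_polyD n)).
by rewrite /rev_poly big1 // => i _; rewrite coef0 scale0r.
Qed.

Lemma rev_polyXn n k : (k <= n)%N -> rev_poly n 'X^k = 'X^(n - k).
Proof.
rewrite -ltnS => kn; rewrite /rev_poly (bigD1 (Ordinal kn)) //= coefXn eqxx scale1r.
rewrite big1 ?addr0 // => i; rewrite -val_eqE /= => ik.
by rewrite coefXn (negPf ik) scale0r.
Qed.

Lemma size_polyM_leqD m n p q : (size p <= m.+1)%N -> (size q <= n.+1)%N ->
  (size (p * q)%R <= (m + n).+1)%N.
Proof. by move=> pm qn; apply: (leq_trans (size_polyMleq _ _)); lia. Qed.

Lemma rev_polyM m n p q : (size p <= m.+1)%N -> (size q <= n.+1)%N ->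
  rev_poly (m + n) (p * q) = rev_poly m p * rev_poly n q.
Proof.
have sumE k (r : {poly F}) : (size r <= k.+1)%N -> r = \sum_(i < k.+1) r`_i *: 'X^i.
  move=> rk; rewrite -poly_def; apply/polyP => i; rewrite coef_poly.
  by case: ltnP => // ki; rewrite nth_default // (leq_trans rk).
move=> /sumE pE /sumE qE; rewrite {1}pE {1}qE big_distrlr /= rev_poly_sum.
rewrite [rev_poly m p]/rev_poly [rev_poly n q]/rev_poly big_distrlr; apply: eq_bigr => i _; rewrite rev_poly_sum.
apply: eq_bigr => j _; have im := ltnSE (ltn_ord i); have jn := ltnSE (ltn_ord j).
rewrite -scalerAl -scalerAr scalerA -exprD rev_polyZ rev_polyXn ?leq_add //=.
rewrite -scalerAl -scalerAr scalerA -exprD; congr (_ *: 'X^_).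
by rewrite addnBA // addnBAC // subnDA.
Qed.

Lemma coef_rev_poly n p k : (k <= n)%N -> (rev_poly n p)`_k = p`_(n - k).
Proof.
move=> kn; have nk : (n - k < n.+1)%N by rewrite ltnS leq_subr.
rewrite coef_sum (bigD1 (Ordinal nk)) //= coefZ coefXn subKn // eqxx mulr1.
rewrite big1 ?addr0 // => i; rewrite -val_eqE /= => ik; rewrite coefZ coefXn.
case: eqVneq => [kE|]; last by rewrite mulr0.
by rewrite kE subKn ?eqxx // -ltnS in ik.
Qed.

Lemma size_rev_poly n p : (size (rev_poly n p) <= n.+1)%N.
Proof.
apply: (leq_trans (size_sum _ _ _)); apply/bigmax_leqP => i _.
by apply: (leq_trans (size_scale_leq _ _)); rewrite size_polyXn ltnS leq_subr.
Qed.

Lemma rev_polyK n p : (size p <= n.+1)%N -> rev_poly n (rev_poly n p) = p.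
Proof.
move=> pn; apply/polyP => i; have [ni|ni] := leqP n.+1 i.
  by rewrite !nth_default // (leq_trans _ ni) // size_rev_poly.
by rewrite !coef_rev_poly ?subKn ?leq_subr.
Qed.

Lemma rev_polyC n c : rev_poly n c%:P = c *: 'X^n.
Proof. by rewrite -[c%:P]mulr1 mul_polyC rev_polyZ -(expr0 'X) rev_polyXn ?subn0. Qed.

Lemma dvdXnP n p : reflect (forall k, (k < n)%N -> p`_k = 0) ('X^n %| p).
Proof.
apply: (iffP idP) => [/dvdpP[q ->] k kn|p0]; first by rewrite coefMXn kn.
rewrite -[p](poly_take_drop n) (_ : take_poly n p = 0) ?add0r ?dvdp_mull //.
by apply/polyP => i; rewrite coef_take_poly coef0; case: ifP => // /p0.
Qed.

Lemma coprimepXn n p : p`_0 != 0 -> coprimep 'X^n p.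
Proof.
move=> p0; apply: coprimep_expl; rewrite coprimep_sym.
by rewrite -['X]subr0 -polyC0 coprimep_XsubC /root horner_coef0.
Qed.

End Reversal.

(** * Padé approximation of a formal square root *)

Section HankelPell.
Variables (R : rcfType) (B : nat -> R) (g Q : {poly R}) (s : R).
Hypothesis s0 : s != 0.
Hypothesis B_conv : forall n, \sum_(i < n.+1) B i * B (n - i)%N = g`_n.
Hypotheses (gQ : g = s ^+ 2 *: rev_poly _ 4 Q) (sizeQ : (size Q <= 5)%N).
Hypotheses (Q0 : Q`_0 = 0) (Q1 : Q`_1 != 0).
Implicit Types (p q : {poly R}) (m n k : nat).

Let S n : {poly R} := \poly_(i < n) B i.

Lemma dvdp_sqrt_series n : 'X^n %| S n ^+ 2 - g.
Proof.
apply/dvdXnP => k kn; rewrite coefB expr2 coefM -B_conv.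
apply/eqP; rewrite subr_eq0; apply/eqP; apply: eq_bigr => i _.
rewrite !coef_poly (leq_ltn_trans (leq_subr _ _) kn).
by rewrite (leq_ltn_trans _ kn) // -ltnS.
Qed.

(** The coefficients of degrees [M + 3] to [2M + 3] of this product form the Hankel matrix applied
    to the coefficients of [q]; the bound on [n] keeps every [B] involved below the truncation. *)
Lemma coef_sqrt_series_rev n M q r : (M.*2.+4 <= n)%N -> (r <= M)%N ->
  (size q <= M.+1)%N ->
  (S n * rev_poly _ M q)`_(M + r + 3) = \sum_(l < M.+1) q`_l * B (l + r + 3)%N.
Proof.
move=> Mn rM qM; rewrite mulr_sumr coef_sum; apply: eq_bigr => l _.
have lM := ltnSE (ltn_ord l).
rewrite -scalerAr coefZ coefMXn ltnNge (leq_trans (leq_subr _ _)) -?addnA ?leq_addr //=.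
rewrite coef_poly; have -> : (M + (r + 3) - (M - l) = l + (r + 3))%N by lia.
by have -> : (l + (r + 3) < n)%N by lia.
Qed.

(** The root 0 of [Q] is simple, so its multiplicity would be even on the left and odd on the
    right. *)
Lemma sqr_eq_simple_rootM p q : p ^+ 2 = Q * q ^+ 2 -> q = 0.
Proof.
move=> pQq; apply/eqP; apply: contraT => q0.
have QE : Q = drop_poly 1 Q * 'X.
  rewrite -{1}[Q](poly_take_drop 1) (_ : take_poly 1 Q = 0) ?add0r //.
  by apply/polyP => -[|i]; rewrite coef_take_poly coef0 ?Q0.
have dQ : ~~ root (drop_poly 1 Q) 0.
  by rewrite /root horner_coef0 coef_drop_poly.
have dQ0 : drop_poly 1 Q != 0 by apply: contraNneq dQ => ->; rewrite root0.
have X0 : 'X != 0 :> {poly R} by rewrite polyX_eq0.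
have p0 : p != 0.
  apply: contraNneq q0 => p0; have := pQq; rewrite p0 expr0n /= => /esym/eqP.
  by rewrite QE !mulf_eq0 (negPf dQ0) (negPf X0) /= orbb.
have mX : mup (0 : R) 'X = 1%N.
  by have := mup_XsubCX 1 (0 : R) 0; rewrite eqxx expr1 polyC0 subr0.
have := congr1 (mup 0) pQq; rewrite QE !expr2 !mupM ?mulf_neq0 //.
by rewrite (mupNroot dQ) mX; lia.
Qed.

(** Reversal turns Pell's equation into [s^2 ph^2 - g qh^2 = s^2 x^(2M+4)]. Hence [sqrt g * qh]
    agrees with [s ph] or [- s ph] below degree [2M + 4], and as [ph] has degree at most [M + 2],
    the coefficients of [q] form a kernel vector. *)
Lemma pell_hankel M p q : size p = M.+3 -> size q = M.+1 ->
  p ^+ 2 - Q * q ^+ 2 = 1 ->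
  \det (\matrix_(i < M.+1, j < M.+1) B (i + j + 3)%N) = 0.
Proof.
move=> sp sq pell.
pose ph := rev_poly _ M.+2 p; pose qh := rev_poly _ M q; pose F := S M.*2.+4.
have ph0 : ph`_0 != 0.
  by rewrite coef_rev_poly // subn0 -[M.+2]/(M.+3.-1) -sp -lead_coefE
             lead_coef_eq0 -size_poly_eq0 sp.
have pellh : s ^+ 2 *: ph ^+ 2 - g * qh ^+ 2 = s ^+ 2 *: 'X^(M.*2.+4).
  rewrite -(subn0 M.*2.+4) -rev_polyXn // expr0 -pell rev_polyB.
  have -> : (M.*2.+4 = M.+2 + M.+2)%N by lia.
  rewrite expr2 rev_polyM ?sp //.
  have -> : (M.+2 + M.+2 = 4 + (M + M))%N by lia.
  rewrite rev_polyM //; last first.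
    by rewrite expr2; apply: (leq_trans (size_polyMleq _ _)); rewrite sq; lia.
  rewrite [q ^+ 2]expr2 rev_polyM ?sq // scalerBr gQ.
  by rewrite -scalerAl -!expr2.
have prod : 'X^(M.*2.+4) %| (s *: ph - F * qh) * (s *: ph + F * qh).
  have -> : (s *: ph - F * qh) * (s *: ph + F * qh) =
            (s ^+ 2 *: ph ^+ 2 - g * qh ^+ 2) - (F ^+ 2 - g) * qh ^+ 2.
    by rewrite -!mul_polyC; ring.
  rewrite pellh; apply: dvdp_sub; first by rewrite -mul_polyC dvdp_mull.
  by rewrite dvdp_mulr // dvdp_sqrt_series.
(* The two factors add up to [2 s ph], nonzero at 0, so one of them is prime to ['X] and the other
   takes the whole power; [e] is [s] or [- s] accordingly. *)
have [e eE] : exists e : R, 'X^(M.*2.+4) %| F * qh - e *: ph.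
  have [e0|e0] := eqVneq (s *: ph + F * qh)`_0 0; last first.
    rewrite Gauss_dvdpl ?coprimepXn // in prod.
    by exists s; rewrite -dvdpNr opprB.
  exists (- s); rewrite scaleNr opprK addrC -(Gauss_dvdpr _ (q := s *: ph - F * qh)) //.
  apply: coprimepXn; apply: contra_neq ph0 => e1.
  have : (s *: ph - F * qh)`_0 + (s *: ph + F * qh)`_0 = 0 by rewrite e0 e1 addr0.
  rewrite -coefD addrACA addNr addr0 -scalerDl coefZ => /eqP.
  by rewrite mulf_eq0 -mulr2n mulrn_eq0 (negPf s0) => /eqP.
apply/eqP/det0P; exists (\row_(l < M.+1) q`_l).
  apply/eqP => /rowP /(_ ord_max); rewrite !mxE -[ord_max : nat]/(M.+1.-1) -sq.
  by rewrite -lead_coefE => /eqP; rewrite lead_coef_eq0 -size_poly_eq0 sq.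
apply/rowP => r; rewrite !mxE; have rM := ltnSE (ltn_ord r).
transitivity ((F * qh)`_(M + r + 3)).
  rewrite coef_sqrt_series_rev ?sq //; apply: eq_bigr => l _.
  by rewrite !mxE.
have := elimT (dvdXnP _ _ _) eE (M + r + 3)%N; rewrite coefB coefZ.
rewrite [ph`_ _]nth_default ?mulr0 ?subr0; last first.
  by rewrite (leq_trans (size_rev_poly _ _ _)) //; lia.
by apply; lia.
Qed.

(** A kernel vector gives [q], and truncating [sqrt g * qh] gives the reversal of [p] up to the
    factor [s]. The kernel condition makes [p^2 - Q q^2] constant; the constant is a nonzero square
    and is scaled to 1. *)
Lemma hankel_pell M :
  \det (\matrix_(i < M.+1, j < M.+1) B (i + j + 3)%N) = 0 ->
  exists p q, [/\ size p = M.+3, size q = M.+1 & p ^+ 2 - Q * q ^+ 2 = 1].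
Proof.
move=> /eqP/det0P[v v0 vH].
pose q := rVpoly v.
have sq : (size q <= M.+1)%N by exact: size_poly.
have q0 : q != 0.
  by apply: contra_neq v0 => q0; rewrite -[v]rVpolyK -/q q0 linear0.
(* One term more than in [pell_hankel]: order [2M + 5] is used to show that [ph] does not vanish at
   0. *)
pose qh := rev_poly _ M q; pose F := S M.*2.+4.+1.
pose ph := s^-1 *: take_poly M.+3 (F * qh).
pose p := rev_poly _ M.+2 ph.
have sph : (size ph <= M.+3)%N.
  by apply: (leq_trans (size_scale_leq _ _)); exact: size_take_poly.
have sp : (size p <= M.+3)%N by exact: size_rev_poly.
have phE : ph = rev_poly _ M.+2 p by rewrite /p rev_polyK.
have approx : 'X^(M.*2.+4) %| F * qh - s *: ph.
  apply/dvdXnP => k kM; rewrite coefB coefZ coefZ mulrA divff // mul1r.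
  rewrite coef_take_poly; case: ltnP => [_|Mk]; first by rewrite subrr.
  have rM : (k - M - 3 < M.+1)%N by lia.
  have kE : k = (M + (k - M - 3) + 3)%N by lia.
  rewrite subr0 {1}kE coef_sqrt_series_rev //; [|lia..].
  have := congr1 (fun w : 'rV_M.+1 => w 0 (Ordinal rM)) vH; rewrite !mxE => vr; rewrite -[RHS]vr.
    by apply: eq_bigr => l _; rewrite !mxE coef_rVpoly_ord.
have sq2 : (size (q ^+ 2) <= (M + M).+1)%N.
  by rewrite expr2; apply: (leq_trans (size_polyMleq _ _)); lia.
have sp2 : (size (p ^+ 2) <= (M.+2 + M.+2).+1)%N.
  by rewrite expr2; apply: (leq_trans (size_polyMleq _ _)); lia.
have sQq : (size (Q * q ^+ 2)%R <= (4 + (M + M)).+1)%N.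
  apply: (leq_trans (size_polyMleq _ _)); move: sizeQ sq2.
  by move: (size Q) (size (q ^+ 2)%R) => x y; lia.
pose D := p ^+ 2 - Q * q ^+ 2.
have sD : (size D <= M.*2.+4.+1)%N.
  rewrite (leq_trans (size_polyD _ _)) // geq_max size_polyN.
  by rewrite (leq_trans sp2) ?(leq_trans sQq) //; lia.
have DE : s ^+ 2 *: rev_poly _ M.*2.+4 D = s ^+ 2 *: ph ^+ 2 - g * qh ^+ 2.
  rewrite rev_polyB.
  have -> : (M.*2.+4 = M.+2 + M.+2)%N by lia.
  rewrite expr2 rev_polyM //.
  have -> : (M.+2 + M.+2 = 4 + (M + M))%N by lia.
  rewrite rev_polyM // [q ^+ 2]expr2 rev_polyM // scalerBr gQ.
  by rewrite -scalerAl -!expr2 -phE.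
have DF : s ^+ 2 *: rev_poly _ M.*2.+4 D =
    (F ^+ 2 - g) * qh ^+ 2 - (F * qh - s *: ph) * (F * qh + s *: ph).
  by rewrite DE -!mul_polyC; ring.
have rDX n : (n <= M.*2.+4)%N -> 'X^(n.+1) %| s ^+ 2 *: rev_poly _ M.*2.+4 D ->
   forall k, (k <= n)%N -> D`_(M.*2.+4 - k) = 0.
  move=> nM /dvdXnP H k kn; have := H k kn; rewrite coefZ coef_rev_poly.
    by move=> /eqP; rewrite mulf_eq0 expf_eq0 (negPf s0) /= => /eqP.
  exact: leq_trans nM.
have dF : 'X^(M.*2.+4) %| F ^+ 2 - g.
  by apply: dvdp_trans (dvdp_sqrt_series _); rewrite dvdp_Pexp2l ?size_polyX.
have DC : D = (D`_0)%:P.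
  apply/polyP => i; rewrite coefC; case: eqVneq => [->//|i0].
  have [Mi|iM] := leqP (M.*2.+4.+1) i; first by rewrite nth_default // (leq_trans sD).
  have := rDX M.*2.+3 (leqnSn _); rewrite DF; move/(_ _ (M.*2.+4 - i)%N).
  rewrite subKn //; apply; last by lia.
  by rewrite dvdp_sub // dvdp_mulr.
have D0 : D`_0 = p`_0 ^+ 2.
  by rewrite coefB !coef0M Q0 mul0r subr0.
have D0n : D`_0 != 0.
  apply: contra_neq q0 => D00; apply: (@sqr_eq_simple_rootM p).
  by apply/eqP; rewrite -subr_eq0 -/D DC D00.
(* If [ph] vanished at 0, so would [F * qh + s *: ph], and the extra power of ['X] would kill the
   last coefficient of [D]. *)
have ph0 : ph`_0 != 0.
  apply: contraNneq D0n => ph0; rewrite -(subnn M.*2.+4).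
  apply/eqP/(rDX M.*2.+4) => //; rewrite DF dvdp_sub //.
    by rewrite dvdp_mulr // dvdp_sqrt_series.
  rewrite exprSr dvdp_mul //; apply/(dvdXnP _ 1) => -[|//] _.
  have -> : F * qh + s *: ph = (F * qh - s *: ph) + (2 * s) *: ph.
    by rewrite -!mul_polyC; ring.
  by rewrite coefD coefZ ph0 mulr0 addr0; exact: (elimT (dvdXnP _ _ _) approx).
(* The constant term of [ph] is the coefficient of degree [M.+2] of [p] and, up to the factor
   [B 0 / s], that of degree [M] of [q]; this makes both degrees exact. *)
have pM : p`_M.+2 != 0 by rewrite -[M.+2]subn0 -coef_rev_poly // -phE.
have qM : q`_M != 0.
  apply: contra_neq ph0 => qM; rewrite coefZ coef_take_poly /= coef0M.
  by rewrite coef_rev_poly // subn0 qM !mulr0.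
have szE (r : {poly R}) n : r`_n != 0 -> (size r <= n.+1)%N -> size r = n.+1.
  move=> rn rs; apply/eqP; rewrite eqn_leq rs; apply: contraNT rn.
  by rewrite -ltnNge ltnS => ?; rewrite nth_default.
pose t := Num.sqrt D`_0.
have t0 : t != 0.
  by rewrite sqrtr_eq0 -ltNge lt_def D0n D0 sqr_ge0.
have t2 : t ^+ 2 = D`_0 by rewrite sqr_sqrtr // D0 sqr_ge0.
exists (t^-1 *: p), (t^-1 *: q).
split; [by rewrite size_scale ?invr_eq0 // (szE p M.+2)
       |by rewrite size_scale ?invr_eq0 // (szE q M)|].
rewrite !exprZn -scalerAr -scalerBr -/D DC -t2 scale_polyC.
by rewrite exprVn mulVf // expf_neq0.
Qed.

End HankelPell.

(** * Matrices of flights and reflections *)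

Section Matrix2.
Variable T : comNzRingType.
Implicit Types (a b c d : T) (A : 'M[T]_2).

Definition mx2 a b c d : 'M[T]_2 :=
  \matrix_(i, j) if i == 0 then (if j == 0 then a else b)
                 else (if j == 0 then c else d).

Lemma mx2E a b c d : [/\ mx2 a b c d 0 0 = a, mx2 a b c d 0 1 = b,
  mx2 a b c d 1 0 = c & mx2 a b c d 1 1 = d].
Proof. by split; rewrite mxE. Qed.

Lemma mx2_eta A : A = mx2 (A 0 0) (A 0 1) (A 1 0) (A 1 1).
Proof.
apply/matrixP => i j; rewrite mxE.
by case: i => [[|[]]] // ilt; case: j => [[|[]]] // jlt;
  rewrite /=; congr (A _ _); apply/val_inj.
Qed.

Lemma mul_mx2 a b c d a' b' c' d' : mx2 a b c d *m mx2 a' b' c' d' =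
  mx2 (a * a' + b * c') (a * b' + b * d') (c * a' + d * c') (c * b' + d * d').
Proof.
rewrite [LHS]mx2_eta; congr mx2;
  by rewrite mxE big_ord_recl big_ord1 !mxE.
Qed.

Lemma mx2_inj a b c d a' b' c' d' : mx2 a b c d = mx2 a' b' c' d' ->
  [/\ a = a', b = b', c = c' & d = d'].
Proof.
move=> /matrixP E.
by split; [have := E 0 0|have := E 0 1|have := E 1 0|have := E 1 1]; rewrite !mxE.
Qed.

Lemma mx2_1 : 1%:M = mx2 1 0 0 1.
Proof. by rewrite [LHS]mx2_eta; congr mx2; rewrite mxE. Qed.

Lemma det_mx2 a b c d : \det (mx2 a b c d) = a * d - b * c.
Proof.
rewrite (expand_det_row _ 0) big_ord_recl big_ord1 /cofactor !det_mx11 !mxE /=.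
by rewrite expr0 expr1; ring.
Qed.

End Matrix2.

(** Derives an equation as a multiple of a known one: [k] is the certificate, and [ring] or [field]
    checks the remaining identity. *)
Lemma eq_of_sub_mul (S : comPzRingType) (k x y e e' : S) :
  e = e' -> x - y = k * (e - e') -> x = y.
Proof. by move=> -> /eqP; rewrite subrr mulr0 subr_eq0 => /eqP. Qed.

(** * Intertwining relations and division of transfer matrices *)

Section Lax.
Variable R : realFieldType.
Implicit Types (c u v d w t m s : R) (A B C D P : {poly R}).

(* At [x = 1 / s] these are the entries of
   [s^2 (a - x) (b - x) [[F(P,v), 1 - F(P,P)], [F(v,v), - F(P,v)]]], where [F]
   is the symmetric bilinear form with matrix [diag(1/(a-x), 1/(b-x))]; the
   coefficient of [s^2] in [laxW] vanishes because [P] is on the ellipse. *)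
Definition laxU u : {poly R} := u%:P * 'X^2 - 'X.
Definition laxV v d : {poly R} := v%:P * 'X^2 + d%:P * 'X.
Definition laxW w : {poly R} := 1 + w%:P * 'X.

Definition lax u v d w : 'M[{poly R}]_2 :=
  mx2 _ (laxV v d) (laxW w) (laxU u) (- laxV v d).

(** [flight] and [bounce] act on columns made of one coordinate of the position and the same
    coordinate of the velocity. At [1/a] or [1/b], [bounce m] subtracts from the velocity that
    coordinate of [m] times the normal. *)
Definition flight t : 'M[{poly R}]_2 := mx2 _ 1 t%:P 0 1.
Definition bounce m : 'M[{poly R}]_2 := mx2 _ 1 0 (- m%:P * 'X) 1.

Lemma flightK t : flight t *m flight (- t) = 1%:M.
Proof. by rewrite mul_mx2 mx2_1; congr mx2; ring. Qed.

Lemma bounceK m : bounce m *m bounce (- m) = 1%:M.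
Proof. by rewrite mul_mx2 mx2_1; congr mx2; ring. Qed.

(** The hypothesis matches the ['X^2] coefficients on the diagonal; for a chord of the ellipse it is
    the formula for its length. *)
Lemma flight_lax u v d w t : t * u = - 2 * v ->
  flight t *m lax u v d w = lax u (- v) (d - t) (w - 2 * t * d + t ^+ 2) *m flight t.
Proof.
move=> tu; have tuP : t%:P * u%:P + 2 * v%:P = 0 :> {poly R}.
  by rewrite -polyCM tu; ring.
rewrite !mul_mx2 /laxU /laxV /laxW; congr mx2.
- by apply: (eq_of_sub_mul _ 'X^2 _ _ _ _ tuP); ring.
- by ring.
- by ring.
- by apply: (eq_of_sub_mul _ (- 'X^2) _ _ _ _ tuP); ring.
Qed.

Lemma bounce_lax u v d w m : m * w = - 2 * v ->
  bounce m *m lax u v d w = lax (u - 2 * m * d - m ^+ 2) (- v) (d + m) w *m bounce m.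
Proof.
move=> mw; have mwP : m%:P * w%:P + 2 * v%:P = 0 :> {poly R}.
  by rewrite -polyCM mw; ring.
rewrite !mul_mx2 /laxU /laxV /laxW; congr mx2.
- by apply: (eq_of_sub_mul _ 'X^2 _ _ _ _ mwP); ring.
- by ring.
- by ring.
- by apply: (eq_of_sub_mul _ (- 'X^2) _ _ _ _ mwP); ring.
Qed.

Lemma coef_laxV v d P n :
  (laxV v d * P)`_n.+2 = v * P`_n + d * P`_n.+1.
Proof. by rewrite mulrDl -[_ * 'X^2 * _]mulrA -[_ * 'X * _]mulrA coefD !coefCM coefXnM coefXM /= subn2. Qed.

Lemma coef_laxU u P n : (laxU u * P)`_n.+2 = u * P`_n - P`_n.+1.
Proof. by rewrite mulrBl -[_ * 'X^2 * _]mulrA coefB coefCM coefXnM coefXM /= subn2. Qed.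

Lemma coef_laxW w P n : (laxW w * P)`_n.+1 = P`_n.+1 + w * P`_n.
Proof. by rewrite mulrDl mul1r -mulrA coefD coefCM coefXM. Qed.

Lemma coefM_top P A (m n : nat) : (size P <= m.+1)%N -> (size A <= n.+1)%N ->
  (P * A)`_(m + n) = P`_m * A`_n.
Proof.
move=> Pm An; rewrite coefM.
have mlt : (m < (m + n).+1)%N by rewrite ltnS leq_addr.
rewrite (bigD1 (Ordinal mlt)) //= addKn big1 ?addr0 // => i.
rewrite -val_eqE neq_ltn /= => /orP[im|mi].
  by rewrite [A`__]nth_default ?mulr0 // (leq_trans An) //; lia.
by rewrite [P`__]nth_default ?mul0r // (leq_trans Pm).
Qed.

Lemma size_drop_top P n : (size P <= n.+1)%N -> P`_n = 0 -> (size P <= n)%N.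
Proof.
move=> Pn Pn0; rewrite leqNgt; apply/negP => nP.
have /eqP sP : size P == n.+1 by rewrite eqn_leq Pn.
by have := lead_coef_eq0 P; rewrite lead_coefE sP Pn0 eqxx -size_poly_eq0 sP.
Qed.

Lemma coef_polyCXM c P n : (c%:P * 'X * P)`_n.+1 = c * P`_n.
Proof. by rewrite -mulrA coefCM coefXM. Qed.

Lemma size_polyCXM c P n : (size P <= n)%N -> (size (c%:P * 'X * P)%R <= n.+1)%N.
Proof.
move=> Pn; rewrite -mulrA mul_polyC.
rewrite (leq_trans (size_scale_leq _ _)) // (leq_trans (size_polyMleq _ _)) //.
by rewrite size_polyX add2n /= ltnS.
Qed.

(* The shape of a product of [k] factors [bounce m *m flight t]; it lets the
   first factor be split off by comparing leading coefficients. *)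
Definition euclid_form k (N : 'M[{poly R}]_2) :=
  [/\ (size (N 0 0)%R <= maxn k 1)%N, (size (N 0 1)%R <= k)%N,
      (size (N 1 0)%R <= k.+1)%N & size (N 1 1) = k.+1].

(** The value at 0 is upper unipotent. The upper right entry is left free, since flights change
    it. *)
Definition unipotent_at0 (N : 'M[{poly R}]_2) :=
  [/\ (N 0 0)`_0 = 1, (N 1 0)`_0 = 0 & (N 1 1)`_0 = 1].

(** One division of a Euclidean algorithm on the columns. Leading coefficients in the intertwining
    relation show that undoing the flight lowers the second column, and then that undoing the
    reflection lowers the first; [\det N = 1] carries this from the lower row to the upper one. *)
Lemma euclid_step k s u d w m t u0 d0 w0 N : s != 0 -> u != 0 ->
  let w' := w - 2 * t * d + t ^+ 2 in
  w' != 0 -> t * u = 2 * s -> m * w' = - 2 * s ->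
  N *m lax u (- s) d w = lax u0 (- s) d0 w0 *m N -> \det N = 1 ->
  euclid_form k.+1 N -> euclid_form k (N *m (flight (- t) *m bounce (- m))).
Proof.
move=> s0 u_0 w' w'0 tu mw inter.
have tv : t * u = -2 * - s by rewrite tu; ring.
have inter' : N *m flight (- t) *m lax u s (d - t) w' =
              lax u0 (- s) d0 w0 *m (N *m flight (- t)).
  have := flight_lax _ _ d w _ tv; rewrite opprK -/w' => fl.
  rewrite [RHS]mulmxA -inter -[lax u (- s) d w]mul1mx.
  have fK : flight (- t) *m flight t = 1%:M.
    by have := flightK (- t); rewrite opprK.
  by rewrite -fK -[flight (- t) *m _ *m _]mulmxA fl -!mulmxA flightK mulmx1.
move: inter inter'; rewrite [N]mx2_eta mulmxA.
move: (N 0 0) (N 0 1) (N 1 0) (N 1 1) => A B C D.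
rewrite !mul_mx2 det_mx2; have [e1 e2 e3 e4] := mx2E _ A B C D.
rewrite /euclid_form e1 e2 e3 e4 {e1 e2 e3 e4} (maxn_idPl _) //.
set B' := A * (- t)%:P + B * 1; set D' := C * (- t)%:P + D * 1.
move=> /mx2_inj[_ _ eq10 _] /mx2_inj[_ _ _ eq11] det1 [sA sB sC sD].
have Z (p : {poly R}) i : (size p <= i)%N -> p`_i = 0 by exact: nth_default.
have D0 : D`_k.+1 != 0.
  by rewrite -[k.+1]/(k.+2.-1) -sD -lead_coefE lead_coef_eq0 -size_poly_eq0 sD.
(* In degree [k + 3] the lower left entry of the relation involves only the leading coefficients of
   [C] and [D]. *)
have uD : u * D`_k.+1 = 2 * s * C`_k.+1.
  have := congr1 (fun p : {poly R} => p`_k.+3) eq10.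
  rewrite ![C * _]mulrC [D * _]mulrC mulNr !coefD coefN !coef_laxV !coef_laxU.
  rewrite (Z A k.+1) // (Z A k.+2) ?(leq_trans sA) // (Z C k.+2) //.
  by rewrite (Z D k.+2) ?sD //; lra.
have DtC : D`_k.+1 = t * C`_k.+1.
  by apply: (mulfI u_0); rewrite uD mulrA [u * t]mulrC tu.
have C0 : C`_k.+1 != 0 by apply: contra_neq D0 => C0; rewrite DtC C0 mulr0.
have sB' : (size B' <= k)%N.
  apply: size_drop_top.
    rewrite (leq_trans (size_polyD _ _)) // geq_max mulr1 sB andbT mulrC mul_polyC.
    by rewrite (leq_trans (size_scale_leq _ _)).
  have := congr1 (fun p : {poly R} => p`_(k + k.+1)) det1.
  rewrite coefB [B * C]mulrC addnC [A * D]mulrC !coefM_top ?sD // coef1 addSn /= => AD.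
  rewrite coefD coefMC mulr1; apply: (mulIf C0).
  by move: AD; rewrite DtC; lra.
have sD' : (size D' <= k.+1)%N.
  apply: size_drop_top.
    rewrite (leq_trans (size_polyD _ _)) // geq_max mulr1 sD leqnn andbT mulrC mul_polyC.
    by rewrite (leq_trans (size_scale_leq _ _)).
  by rewrite coefD coefMC mulr1 DtC; ring.
have CD' : w' * C`_k.+1 = 2 * s * D'`_k.
  have eq11' : laxW w' * C - laxV s (d - t) * D' =
               laxU u0 * B' - laxV (- s) d0 * D'.
    by apply: (eq_of_sub_mul _ 1 _ _ _ _ eq11); rewrite /B' /D'; ring.
  have := congr1 (fun p : {poly R} => p`_k.+2) eq11'.
  rewrite !coefB coef_laxW !coef_laxV !coef_laxU.
  rewrite (Z C k.+2) // (Z D' k.+1) // (Z B' k) // (Z B' k.+1) ?(leq_trans sB') //.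
  by lra.
have D'0 : D'`_k != 0.
  apply: contra_neq C0 => D'0; apply: (mulfI w'0).
  by rewrite CD' D'0 !mulr0.
have CmD : C`_k.+1 + m * D'`_k = 0.
  have n0 : 2 * s != 0 by rewrite mulf_neq0.
  by apply: (mulfI n0); rewrite mulr0 mulrDr mulrCA -CD' mulrA mw; ring.
rewrite !mxE /=.
have -> : A * (1 * 0 + (- t)%:P * 1) + B * (0 * 0 + 1 * 1) = B' by rewrite /B'; ring.
have -> : C * (1 * 0 + (- t)%:P * 1) + D * (0 * 0 + 1 * 1) = D' by rewrite /D'; ring.
have -> : A * (1 * 1 + (- t)%:P * (- (- m)%:P * 'X)) + B * (0 * 1 + 1 * (- (- m)%:P * 'X))
          = A + m%:P * 'X * B' by rewrite /B'; ring.
have -> : C * (1 * 1 + (- t)%:P * (- (- m)%:P * 'X)) + D * (0 * 1 + 1 * (- (- m)%:P * 'X))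
          = C + m%:P * 'X * D' by rewrite /D'; ring.
split=> //.
- have sA' : (size (A + m%:P * 'X * B')%R <= k.+1)%N.
    by rewrite (leq_trans (size_polyD _ _)) // geq_max sA size_polyCXM.
  (* For [k = 0] the size bound on this entry stays at 1, as the identity matrix demands; only a
     positive [k] needs a cancellation. *)
  case: k => [|k] in D0 DtC C0 uD sA sB sC sD sB' sD' CD' D'0 CmD sA' det1 *; first by [].
  rewrite maxnC (maxn_idPr _) //; apply: size_drop_top => //.
  rewrite coefD coef_polyCXM.
  have det1' : A * D' - B' * C = 1.
    by apply: (eq_of_sub_mul _ 1 _ _ _ _ det1); rewrite /B' /D'; ring.
  have := congr1 (fun p : {poly R} => p`_(k.+1 + k.+1)) det1'.
  rewrite coefB coefM_top // addSnnS coefM_top // coef1 addnS /= => AD.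
  apply: (mulIf C0); rewrite mul0r.
  transitivity (A`_k.+1 * (C`_k.+2 + m * D'`_k.+1) -
                m * (A`_k.+1 * D'`_k.+1 - B'`_k * C`_k.+2)); first by ring.
  by rewrite CmD AD; ring.
- apply: size_drop_top; first by rewrite (leq_trans (size_polyD _ _)) // geq_max sC size_polyCXM.
  by rewrite coefD coef_polyCXM.
- apply/eqP; rewrite eqn_leq sD' ltnNge; apply: contraNN D'0 => ?.
  by rewrite nth_default.
Qed.


Lemma unipotent_at0_step t m N : unipotent_at0 N ->
  unipotent_at0 (N *m (flight (- t) *m bounce (- m))).
Proof.
rewrite [N]mx2_eta mulmxA /unipotent_at0 !mul_mx2 !mxE /= => -[A0 C0 D0].
have X0 (c : R) P : (P * (- c%:P * 'X))`_0 = 0.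
  by rewrite mulrA coefMX.
by split; rewrite !(mulr1, mulr0, addr0, add0r) !(coefD, X0, coefMC) ?C0 ?addr0 ?mul0r ?add0r.
Qed.

Lemma euclid_form0 N : euclid_form 0 N -> unipotent_at0 N -> N = 1%:M.
Proof.
move=> [sA sB sC sD] [A0 C0 D0]; rewrite [N]mx2_eta mx2_1.
have cst (p : {poly R}) c : (size p <= 1)%N -> p`_0 = c -> p = c%:P.
  by move=> /size1_polyC pE p0; rewrite pE p0.
congr mx2.
- exact: cst.
- by apply/eqP; rewrite -size_poly_leq0.
- exact: cst.
- by apply: cst => //; rewrite sD.
Qed.

End Lax.

(** * Abstract chains of flights and reflections *)

Section Chain.
Variable R : realFieldType.
Variables (s : R) (u d w t m : nat -> R).
Hypotheses (s0 : s != 0) (u0 : forall k, u k != 0) (w0 : forall k, w k != 0).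
Hypothesis tu : forall k, t k * u k = 2 * s.
Hypothesis mw : forall k, m k * w k.+1 = - 2 * s.
Hypothesis wS : forall k, w k.+1 = w k - 2 * t k * d k + t k ^+ 2.
Hypothesis dS : forall k, d k.+1 = d k - t k + m k.
Hypothesis uS : forall k, u k.+1 = u k - 2 * m k * (d k - t k) - m k ^+ 2.

Local Notation L k := (lax _ (u k) (- s) (d k) (w k)).

Fixpoint transfer k : 'M[{poly R}]_2 :=
  if k is j.+1 then bounce _ (m j) *m flight _ (t j) *m transfer j else 1%:M.

Lemma step_lax k :
  bounce _ (m k) *m flight _ (t k) *m L k = L k.+1 *m (bounce _ (m k) *m flight _ (t k)).
Proof.
have tv : t k * u k = - 2 * - s by rewrite tu; ring.
have mv : m k * w k.+1 = - 2 * s := mw k.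
rewrite -mulmxA (flight_lax _ _ _ _ _ _ tv) opprK -wS mulmxA.
by rewrite (bounce_lax _ _ _ _ _ _ mv) -uS -dS mulmxA.
Qed.

Lemma transfer_lax k : transfer k *m L 0 = L k *m transfer k.
Proof.
elim: k => [|k IH]; first by rewrite /= mul1mx mulmx1.
by rewrite [transfer _]/= -mulmxA IH mulmxA step_lax -mulmxA.
Qed.

Lemma det_transfer k : \det (transfer k) = 1.
Proof.
elim: k => [|k IH]; first by rewrite det1.
by rewrite /= !det_mulmx IH !det_mx2; ring.
Qed.

Lemma t_neq0 k : t k != 0.
Proof.
have : t k * u k != 0 by rewrite tu mulf_neq0.
by apply: contra_neq => ->; rewrite mul0r.
Qed.

Lemma m_neq0 k : m k != 0.
Proof.
have : m k * w k.+1 != 0 by rewrite mw mulf_neq0 // oppr_eq0.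
by apply: contra_neq => ->; rewrite mul0r.
Qed.

(** Each step raises the degree of the lower right entry by exactly one: its leading coefficient is
    multiplied by [- m k * t k], which is nonzero. *)
Lemma transfer_form k : euclid_form _ k (transfer k) /\ unipotent_at0 _ (transfer k).
Proof.
elim: k => [|k [+ +]].
  rewrite /= mx2_1; split; first by split; rewrite mxE /= ?size_polyC ?oner_eq0 ?eqxx.
  by split; rewrite mxE /= coefC.
rewrite /= [transfer k]mx2_eta -mulmxA !mul_mx2.
move: (transfer k 0 0) (transfer k 0 1) (transfer k 1 0) (transfer k 1 1) => A B C D.
rewrite /euclid_form /unipotent_at0 !mxE /= => -[sA sB sC sD] [A0 C0 D0].
have cX0 c (p : {poly R}) : (c%:P * 'X * p)`_0 = 0.
  by rewrite -mulrA coefCM coefXM mulr0.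
have sA' : (size (A + (t k)%:P * C)%R <= k.+1)%N.
  rewrite (leq_trans (size_polyD _ _)) // geq_max (leq_trans sA) ?geq_max ?leqnSn //=.
  by rewrite mul_polyC (leq_trans (size_scale_leq _ _)).
have sB' : (size (B + (t k)%:P * D)%R <= k.+1)%N.
  rewrite (leq_trans (size_polyD _ _)) // geq_max (leq_trans sB) ?leqnSn //=.
  by rewrite mul_polyC (leq_trans (size_scale_leq _ _)) ?sD.
have -> : 1 * (1 * A + (t k)%:P * C) + 0 * (0 * A + 1 * C) = A + (t k)%:P * C by ring.
have -> : 1 * (1 * B + (t k)%:P * D) + 0 * (0 * B + 1 * D) = B + (t k)%:P * D by ring.
have -> : - (m k)%:P * 'X * (1 * A + (t k)%:P * C) + 1 * (0 * A + 1 * C) =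
          C + (- m k)%:P * 'X * (A + (t k)%:P * C) by ring.
have -> : - (m k)%:P * 'X * (1 * B + (t k)%:P * D) + 1 * (0 * B + 1 * D) =
          D + (- m k)%:P * 'X * (B + (t k)%:P * D) by ring.
split; split.
- by rewrite maxnC (maxn_idPr _).
- by [].
- by rewrite (leq_trans (size_polyD _ _)) // geq_max size_polyCXM // (leq_trans sC).
- have sD' : (size (D + (- m k)%:P * 'X * (B + (t k)%:P * D))%R <= k.+2)%N.
    by rewrite (leq_trans (size_polyD _ _)) // geq_max size_polyCXM // sD leqnSn.
  apply/eqP; rewrite eqn_leq sD' ltnNge; apply/negP => sD''.
  have /eqP : (D + (- m k)%:P * 'X * (B + (t k)%:P * D))`_k.+1 = 0 by rewrite nth_default.
  rewrite coefD coef_polyCXM coefD coefCM [D`_k.+1]nth_default ?sD // [B`_k]nth_default //.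
  rewrite !add0r !mulf_eq0 oppr_eq0.
  rewrite (negPf (t_neq0 k)) (negPf (m_neq0 k)) /=.
  by rewrite -[k]/(k.+1.-1) -sD -lead_coefE lead_coef_eq0 -size_poly_eq0 sD.
- by rewrite coefD coefCM C0 mulr0 addr0.
- by rewrite coefD cX0 addr0.
- by rewrite coefD cX0 addr0.
Qed.

(** The steps of the chain are divided off [N] on the right one at a time, the quotient [N']
    carrying [L k] to [L 0]. After [n] steps only the identity can be left. *)
Lemma transfer_unique n N : N *m L 0 = L 0 *m N -> \det N = 1 ->
  euclid_form _ n N -> unipotent_at0 _ N -> transfer n = N.
Proof.
move=> NL dN eN uN.
have quot k : (k <= n)%N -> exists N', [/\ N' *m transfer k = N,
    N' *m L k = L 0 *m N', \det N' = 1, euclid_form _ (n - k) N' & unipotent_at0 _ N'].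
  elim: k => [|k IH] kn; first by exists N; rewrite subn0 mulmx1.
  have [N' [N'M N'L dN' eN' uN']] := IH (ltnW kn).
  pose S := bounce _ (m k) *m flight _ (t k).
  pose S' := flight _ (- t k) *m bounce _ (- m k).
  have SS' : S *m S' = 1%:M.
    by rewrite mulmxA -[_ *m _ *m flight _ _]mulmxA flightK mulmx1 bounceK.
  have S'S : S' *m S = 1%:M by apply: mulmx1C.
  exists (N' *m S'); split.
  - by rewrite /= -/S -N'M mulmxA -[_ *m S' *m S]mulmxA S'S mulmx1.
  - have -> : L k.+1 = S *m L k *m S'.
      by rewrite step_lax -mulmxA -/S SS' mulmx1.
    by rewrite 2!mulmxA -[N' *m S' *m S]mulmxA S'S mulmx1 mulmxA -N'L.
  - by rewrite det_mulmx dN' !det_mulmx !det_mx2; ring.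
  - rewrite -subnSK // in eN'.
    apply: euclid_step N'L dN' eN' => //; [by rewrite -wS|by rewrite -wS].
  - exact: unipotent_at0_step.
have [N' [<- _ _ eN' uN']] := quot n (leqnn n).
by rewrite subnn in eN'; rewrite (euclid_form0 _ _ eN' uN') mul1mx.
Qed.

End Chain.

(** * Solutions of Pell's equation from closed chains, and conversely *)

Section CoprimeSquares.
Variable F : fieldType.
Implicit Types (u v q D E p : {poly F}) (c : F).

(** The witness is [g = gcdp u q]: once it is cancelled, coprimality shows that [u %/ g] and [g]
    divide each other. *)
Lemma coprimep_mul_sqr u v q c : c != 0 -> q != 0 -> coprimep u v ->
  u * v = c *: q ^+ 2 -> exists c' w, u = c' *: w ^+ 2.
Proof.
move=> c0 q0 uv uvq; pose g := gcdp u q.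
have g0 : g != 0 by rewrite gcdp_eq0 negb_and q0 orbT.
have uE : u = u %/ g * g by rewrite divpK // dvdp_gcdl.
have qE : q = q %/ g * g by rewrite divpK // dvdp_gcdr.
have cop : coprimep (u %/ g) (q %/ g) by rewrite coprimep_div_gcd // q0 orbT.
have eq1 : (u %/ g) * v = c *: (g * (q %/ g) ^+ 2).
  apply: (mulIf g0); rewrite mulrAC -uE uvq {1}qE -!mul_polyC; ring.
have : u %/ g %= g.
  apply/andP; split.
    rewrite -(Gauss_dvdpl _ (q := (q %/ g) ^+ 2)); last exact: coprimep_expr.
    by rewrite -(dvdpZr _ _ c0) -eq1 dvdp_mulr.
  have gv : coprimep g v by apply: coprimep_dvdr uv; exact: dvdp_gcdl.
  by rewrite -(Gauss_dvdpl _ gv) eq1 dvdpZr // dvdp_mulr.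
move=> /eqpf_eq[k k0 kE]; exists k, g.
by rewrite {1}uE kE -scalerAl expr2.
Qed.

(** [p - 1] and [p + 1] differ by 2, so their cofactors [v] and [u] are coprime, with product
    [c *: q ^+ 2]. *)
Lemma sqr_sub1_factor p q D E c : c != 0 -> q != 0 -> 2 != 0 :> F ->
  D != 0 -> E != 0 ->
  p ^+ 2 - 1 = c *: (D * E * q ^+ 2) -> D %| p - 1 -> E %| p + 1 ->
  exists c1 c2 g h, p + 1 = c1 *: (E * g ^+ 2) /\ p - 1 = c2 *: (D * h ^+ 2).
Proof.
move=> c0 q0 n2 D0 E0 pq /dvdpP[v vE] /dvdpP[u uE].
have uv : u * v = c *: q ^+ 2.
  apply: (mulfI (mulf_neq0 D0 E0)).
  transitivity ((p + 1) * (p - 1)); first by rewrite vE uE; ring.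
  by rewrite -scalerAr -pq; ring.
have cop : coprimep u v.
  apply/Bezout_coprimepP; exists ((2^-1)%:P * E, - (2^-1)%:P * D).
  rewrite /= (_ : _ + _ = 1) ?eqpxx //.
  transitivity ((2^-1)%:P * (u * E - v * D)); first by ring.
  rewrite -uE -vE (_ : _ - _ = 2%:P); first by rewrite -polyCM mulVf.
  by rewrite -[2]/(1 + 1) polyCD; ring.
have [c1 [g gE]] := coprimep_mul_sqr _ _ _ _ c0 q0 cop uv.
have vu : v * u = c *: q ^+ 2 by rewrite mulrC.
rewrite coprimep_sym in cop.
have [c2 [h hE]] := coprimep_mul_sqr _ _ _ _ c0 q0 cop vu.
exists c1, c2, g, h; rewrite uE vE gE hE -!scalerAl.
by rewrite [E * _]mulrC [D * _]mulrC.
Qed.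

End CoprimeSquares.

Section LaxCommutant.
Variable R : realFieldType.
Implicit Types (u v d w r : R) (p q : {poly R}) (M : 'M[{poly R}]_2).

(** The point is that [q = B / W] is a polynomial. [W] has a single root [r]; if [B] did not vanish
    there, [U] and [V] would, and [r] would be a double root of [G]. *)
Lemma lax_commutant u v d w M (L := lax _ u v d w)
    (G := laxV _ v d ^+ 2 + laxU _ u * laxW _ w) :
  w != 0 -> (forall r, root G r -> ~~ root G^`() r) -> M *m L = L *m M ->
  exists p q, M = mx2 _ (p + q * laxV _ v d) (q * laxW _ w)
                        (q * laxU _ u) (p - q * laxV _ v d).
Proof.
rewrite /L /G => w0; set U := laxU _ u; set V := laxV _ v d; set W := laxW _ w.
move=> sqfree; rewrite [M]mx2_eta.
move: (M 0 0) (M 0 1) (M 1 0) (M 1 1) => A B C D.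
rewrite /lax -/U -/V -/W !mul_mx2 => /mx2_inj[eq00 eq01 _ _].
have e00 : B * U = W * C.
  by apply: (eq_of_sub_mul _ 1 _ _ _ _ eq00); ring.
have e01 : (A - D) * W = B * V *+ 2.
  by apply: (eq_of_sub_mul _ 1 _ _ _ _ eq01); ring.
pose r := - w^-1.
have WE : W = w%:P * ('X - r%:P).
  by rewrite mulrBr -polyCM /r mulrN mulfV // polyCN /W /laxW; ring.
have Wr : W.[r] = 0 by rewrite WE !hornerE subrr mulr0.
have w0P : w%:P != 0 by rewrite polyC_eq0.
have W0 : W != 0 by rewrite WE mulf_neq0 // polyXsubC_eq0.
clearbody U V W; have Br : B.[r] = 0.
  apply/eqP; apply: contraT => Br.
  have Vr : V.[r] = 0.
    have := congr1 (horner^~ r) e01; rewrite hornerMn !hornerM Wr mulr0 => /esym/eqP.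
    by rewrite mulrn_eq0 mulf_eq0 (negPf Br) /= => /eqP.
  have Ur : U.[r] = 0.
    have := congr1 (horner^~ r) e00; rewrite !hornerE Wr mul0r => /eqP.
    by rewrite mulf_eq0 (negPf Br) /= => /eqP.
  have Gr : root (V ^+ 2 + U * W) r by rewrite /root hornerD horner_exp hornerM Vr Ur Wr mulr0 expr0n addr0.
  move: (sqfree r Gr); rewrite /root expr2 derivD !derivM !(hornerD, hornerM) Vr Ur Wr.
  by rewrite !(mul0r, mulr0) !addr0 eqxx.
have [q qE] : exists q, B = q * W.
  have /dvdpP[q ->] : 'X - r%:P %| B by rewrite dvdp_XsubCl /root Br.
  exists ((w^-1)%:P * q); rewrite WE.
  rewrite mulrACA -polyCM [w^-1 * _]mulVf //; ring.
have CE : C = q * U.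
  by apply: (mulfI W0); rewrite -e00 qE; ring.
have ADE : A - D = 2 * (q * V).
  by apply: (mulIf W0); rewrite e01 qE; ring.
exists ((2^-1)%:P * (A + D)), q; rewrite -qE -CE.
have h2 : (2^-1)%:P * 2 = 1 :> {poly R}.
  by rewrite -[2]/(2%:R) -polyC_natr -polyCM mulVf.
have qVE : q * V = (2^-1)%:P * (A - D).
  by rewrite ADE; apply: (eq_of_sub_mul _ (- (q * V)) _ _ _ _ h2); ring.
congr mx2; rewrite qVE.
- by apply: (eq_of_sub_mul _ (- A) _ _ _ _ h2); ring.
- by apply: (eq_of_sub_mul _ (- D) _ _ _ _ h2); ring.
Qed.

End LaxCommutant.

(** * Values of a Pell solution at the roots of [Q] *)

Section PellRoots.
Variable R : rcfType.
Variables (x1 x2 x3 c : R).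
Hypotheses (c0 : c != 0) (x10 : x1 != 0) (x20 : x2 != 0) (x30 : x3 != 0).
Hypotheses (x12 : x1 != x2) (x13 : x1 != x3) (x23 : x2 != x3).
Implicit Types (p q g h : {poly R}).

Let Q : {poly R} := 'X * ('X - x1%:P) * ('X - x2%:P) * ('X - x3%:P).

Lemma size_scale_mul_sqr k p g : k *: (p * g ^+ 2) != 0 ->
  size (k *: (p * g ^+ 2)) = (size p + (size g).*2 - 2)%N.
Proof.
rewrite scaler_eq0 negb_or => /andP[k0]; rewrite mulf_eq0 expf_eq0 negb_or /=.
move=> /andP[p0 g0]; rewrite size_scale // size_mul ?expf_neq0 //.
rewrite expr2 size_mul //; move: p0 g0; rewrite -!size_poly_gt0.
by move: (size p) (size g) => i j; lia.
Qed.

Lemma dvdp_sub_value p e (xs : seq R) : uniq xs ->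
  all (fun x => p.[x] == e) xs -> \prod_(x <- xs) ('X - x%:P) %| p - e%:P.
Proof.
move=> uxs /allP pe; apply: uniq_roots_dvdp; last by rewrite uniq_rootsE.
by apply/allP => x /pe /eqP pxe; rewrite /root !hornerE pxe subrr.
Qed.

Lemma pell_value p q x : root Q x -> p ^+ 2 - 1 = c *: (Q * q ^+ 2) ->
  p.[x] = 1 \/ p.[x] = -1.
Proof.
move=> /rootP Qx pq; have := congr1 (horner^~ x) pq.
rewrite hornerZ hornerM Qx mul0r mulr0 !hornerE => /eqP; rewrite subr_eq0 sqrf_eq1.
by move=> /orP[] /eqP; [left|right].
Qed.

(** If [p.[x3] = 1], all of [Q] divides [p - 1], so [p + 1 = c1 g^2] and [p - 1 = c2 Q h^2];
    subtracting and halving gives the smaller solution. *)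
Lemma pell_halve n p q : size p = n.+1 -> (0 < n)%N -> ~~ odd n ->
  p ^+ 2 - 1 = c *: (Q * q ^+ 2) -> p.[0] = 1 -> p.[x1] = 1 -> p.[x2] = 1 ->
  exists p1 q1, [/\ size p1 = n./2.+1, size q1 = n./2.-1 & p1 ^+ 2 - Q * q1 ^+ 2 = 1].
Proof.
move=> sp n0 nev pq p_0 p_1 p_2.
have sp1 e : size (p + e%:P) = n.+1.
  by rewrite size_polyDl // sp (leq_ltn_trans (size_polyC_leq1 _)).
have pe0 e : p + e%:P != 0 by rewrite -size_poly_eq0 sp1.
have q0 : q != 0.
  apply/eqP => q0; move/eqP: pq; rewrite q0 expr0n mulr0 scaler0.
  by rewrite -[X in _ - X](expr1n _ 2) subr_sqr mulf_eq0 -polyC1 -polyCN !(negPf (pe0 _)).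
have n2 : 2 != 0 :> R by rewrite pnatr_eq0.
have X0 (x : R) : 'X - x%:P != 0 by rewrite polyXsubC_eq0.
have QX : Q = ('X - 0%:P) * ('X - x1%:P) * ('X - x2%:P) * ('X - x3%:P).
  by rewrite polyC0 subr0.
have Q0 : Q != 0 by rewrite QX !mulf_neq0 ?X0.
have uq : uniq [:: 0; x1; x2; x3].
  by rewrite /= !inE !negb_or ![0 == _]eq_sym x10 x20 x30 x12 x13 x23.
have rx3 : root Q x3 by rewrite QX !rootM !root_XsubC eqxx !orbT.
have [p_3|p_3] := pell_value p q x3 rx3 pq.
- have D1 : Q %| p - 1.
    have := dvdp_sub_value p 1 _ uq; rewrite /= p_0 p_1 p_2 p_3 !eqxx => /(_ isT).
    by rewrite !big_cons big_nil mulr1 QX !mulrA.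
  have pq' : p ^+ 2 - 1 = c *: (Q * 1 * q ^+ 2) by rewrite mulr1.
  have [c1 [c2 [g [h [gE hE]]]]] :=
    sqr_sub1_factor _ _ _ _ _ _ c0 q0 n2 Q0 (oner_neq0 _) pq' D1 (dvd1p _).
  (* Positivity is needed for real square roots. The value 2 of [p + 1] at 0 settles [c1]; then
     [p + 1] and [p - 1] share a positive leading coefficient, which settles [c2] as [Q] is
     monic. *)
  have c1_gt0 : 0 < c1.
    have := congr1 (horner^~ 0) gE; rewrite !hornerE p_0 /= => g2.
    have : 0 < c1 * g.[0] ^+ 2 by lra.
    by apply: contraTT; rewrite -!leNgt => ?; rewrite mulr_le0_ge0 // sqr_ge0.
  have lead e : lead_coef (p + e%:P) = lead_coef p.
    by rewrite lead_coefDl // sp (leq_ltn_trans (size_polyC_leq1 _)).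
  have lp_gt0 : 0 < lead_coef p.
    have := lead 1; rewrite gE mul1r lead_coefZ lead_coef_exp => <-.
    rewrite mulr_gt0 // lt_def sqr_ge0 andbT expf_eq0 /= lead_coef_eq0.
    by apply: contra_neq (pe0 1) => g0; rewrite gE g0 expr0n mulr0 scaler0.
  have c2_gt0 : 0 < c2.
    have := lead (-1); rewrite polyCN hE lead_coefZ lead_coefM lead_coef_exp.
    rewrite QX !lead_coefM !lead_coefXsubC !mul1r => l2; have : 0 < c2 * lead_coef h ^+ 2 by rewrite l2.
    by apply: contraTT; rewrite -!leNgt => ?; rewrite mulr_le0_ge0 // sqr_ge0.
  have k1_gt0 : 0 < c1 / 2 by rewrite divr_gt0.
  have k2_gt0 : 0 < c2 / 2 by rewrite divr_gt0.
  have sg : size g = n./2.+1.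
    have := size_scale_mul_sqr c1 1 g; rewrite -gE (sp1 1) size_poly1 => /(_ (pe0 1)).
    have : g != 0 by apply: contra_neq (pe0 1) => g0; rewrite gE g0 expr0n mulr0 scaler0.
    by rewrite -size_poly_gt0; move: (size g) nev => i; clear; lia.
  have sh : size h = n./2.-1.
    have := size_scale_mul_sqr c2 Q h; rewrite -hE -[- 1 : {poly R}]polyCN sp1 => /(_ (pe0 (-1))).
    have h0 : h != 0.
      by apply: contra_neq (pe0 (-1)) => h0; rewrite polyCN hE h0 expr0n mulr0 scaler0.
    have -> : size Q = 5%N.
      rewrite QX -[in RHS](size_prod_XsubC [:: 0; x1; x2; x3] id) !big_cons big_nil.
      by rewrite mulr1 !mulrA.
    by move: h0; rewrite -size_poly_gt0; move: (size h) nev => i; clear; lia.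
  exists (Num.sqrt (c1 / 2) *: g), (Num.sqrt (c2 / 2) *: h); split.
  + by rewrite size_scale // sqrtr_eq0 -ltNge.
  + by rewrite size_scale // sqrtr_eq0 -ltNge.
  + rewrite !exprZn !sqr_sqrtr ?ltW // -scalerAr.
    rewrite [c1 / 2]mulrC [c2 / 2]mulrC -!scalerA -[g ^+ 2]mul1r -gE -hE -scalerBr.
    rewrite (_ : _ - _ = 2%:P); first by rewrite scale_polyC mulVf.
    by rewrite -[2]/(1 + 1) polyCD; ring.
(* Here [p + 1] would be a constant times [('X - x3) g^2], of odd degree, whereas [n] is even. *)
- have D1 : ('X - 0%:P) * ('X - x1%:P) * ('X - x2%:P) %| p - 1.
    have /= := dvdp_sub_value p 1 [:: 0; x1; x2].
    rewrite p_0 p_1 p_2 !eqxx !big_cons big_nil mulr1 ?mulrA; apply=> //.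
    by rewrite /= !inE !negb_or ![0 == _]eq_sym x10 x20 x12.
  have E1 : 'X - x3%:P %| p + 1.
    by rewrite dvdp_XsubCl /root !hornerE p_3 addNr.
  have DE0 : ('X - 0%:P) * ('X - x1%:P) * ('X - x2%:P) != 0 by rewrite !mulf_neq0 ?X0.
  rewrite QX in pq.
  have [c1 [c2 [g [h [gE hE]]]]] :=
    sqr_sub1_factor _ _ _ _ _ _ c0 q0 n2 DE0 (X0 x3) pq D1 E1.
  have := size_scale_mul_sqr c1 ('X - x3%:P) g.
  rewrite -gE (sp1 1) size_XsubC => /(_ (pe0 1)).
  by move: (size g) nev => i; clear; lia.
Qed.

(** If [p.[x3] = 1], then [p + 1] is a constant times [('X - x1) g^2] and cannot take the value 2 on
    both sides of [x1]. If [p.[x3] = -1], then [p + 1] has even degree. *)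
Lemma pell_odd_false n p q : size p = n.+1 -> (0 < n)%N -> odd n -> 0 < x1 < x2 ->
  p ^+ 2 - 1 = c *: (Q * q ^+ 2) -> p.[0] = 1 -> p.[x1] = -1 -> p.[x2] = 1 -> False.
Proof.
move=> sp n0 nodd /andP[x1_gt0 x12_lt] pq p_0 p_1 p_2.
have sp1 e : size (p + e%:P) = n.+1.
  by rewrite size_polyDl // sp (leq_ltn_trans (size_polyC_leq1 _)).
have pe0 e : p + e%:P != 0 by rewrite -size_poly_eq0 sp1.
have q0 : q != 0.
  apply/eqP => q0; move/eqP: pq; rewrite q0 expr0n mulr0 scaler0.
  by rewrite -[X in _ - X](expr1n _ 2) subr_sqr mulf_eq0 -polyC1 -polyCN !(negPf (pe0 _)).
have n2 : 2 != 0 :> R by rewrite pnatr_eq0.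
have X0 (x : R) : 'X - x%:P != 0 by rewrite polyXsubC_eq0.
have rx3 : root Q x3 by rewrite !rootM !root_XsubC eqxx !orbT.
have [p_3|p_3] := pell_value p q x3 rx3 pq.
- have D1 : ('X - 0%:P) * ('X - x2%:P) * ('X - x3%:P) %| p - 1.
    have /= := dvdp_sub_value p 1 [:: 0; x2; x3].
    rewrite p_0 p_2 p_3 !eqxx !big_cons big_nil mulr1 ?mulrA; apply=> //.
    by rewrite /= !inE !negb_or ![0 == _]eq_sym x30 x20 x23.
  have E1 : 'X - x1%:P %| p + 1.
    by rewrite dvdp_XsubCl /root !hornerE p_1 addNr.
  have D0 : ('X - 0%:P) * ('X - x2%:P) * ('X - x3%:P) != 0 by rewrite !mulf_neq0 ?X0.
  have pq' : p ^+ 2 - 1 =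
     c *: (('X - 0%:P) * ('X - x2%:P) * ('X - x3%:P) * ('X - x1%:P) * q ^+ 2).
    by rewrite pq /Q; congr (_ *: (_ * _)); rewrite polyC0; ring.
  have [c1 [c2 [g [h [gE hE]]]]] :=
    sqr_sub1_factor _ _ _ _ _ _ c0 q0 n2 D0 (X0 x1) pq' D1 E1.
  have := congr1 (horner^~ 0) gE; have := congr1 (horner^~ x2) gE.
  rewrite !(hornerZ, hornerD) !(hornerM, hornerXsubC) !hornerC p_0 p_2 -!expr2 => e2 e0.
  have g2 := sqr_ge0 g.[x2]; have g0 := sqr_ge0 g.[0].
  have [c1_ge0|c1_lt0] := leP 0 c1.
    have : 0 <= c1 * (x1 * g.[0] ^+ 2) by rewrite mulr_ge0 // mulr_ge0 // ltW.
    by move: e0; lra.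
  have : 0 <= (- c1) * ((x2 - x1) * g.[x2] ^+ 2).
    by rewrite mulr_ge0 ?oppr_ge0 ?(ltW c1_lt0) // mulr_ge0 // subr_ge0 ltW.
  lra.
- have D1 : ('X - 0%:P) * ('X - x2%:P) %| p - 1.
    have /= := dvdp_sub_value p 1 [:: 0; x2].
    rewrite p_0 p_2 !eqxx !big_cons big_nil mulr1 ?mulrA; apply=> //.
    by rewrite /= !inE ![0 == _]eq_sym x20.
  have E1 : ('X - x1%:P) * ('X - x3%:P) %| p + 1.
    have /= := dvdp_sub_value p (-1) [:: x1; x3].
    rewrite p_1 p_3 !eqxx !big_cons big_nil mulr1 ?mulrA polyCN opprK; apply=> //.
    by rewrite /= !inE x13.
  have D0 : ('X - 0%:P) * ('X - x2%:P) != 0 by rewrite !mulf_neq0 ?X0.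
  have E0 : ('X - x1%:P) * ('X - x3%:P) != 0 by rewrite !mulf_neq0 ?X0.
  have pq' : p ^+ 2 - 1 =
     c *: (('X - 0%:P) * ('X - x2%:P) * (('X - x1%:P) * ('X - x3%:P)) * q ^+ 2).
    by rewrite pq /Q; congr (_ *: (_ * _)); rewrite polyC0; ring.
  have [c1 [c2 [g [h [gE hE]]]]] :=
    sqr_sub1_factor _ _ _ _ _ _ c0 q0 n2 D0 E0 pq' D1 E1.
  have := size_scale_mul_sqr c1 (('X - x1%:P) * ('X - x3%:P)) g.
  rewrite -gE (sp1 1) size_mul ?X0 // !size_XsubC => /(_ (pe0 1)).
  by move: (size g) nodd => i; clear; lia.
Qed.

End PellRoots.

(** * From a solution of Pell's equation to the transfer matrix *)

Section PellTransfer.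
Variable R : realFieldType.
Variables (s : R) (u d w t m : nat -> R).
Hypotheses (s0 : s != 0) (u0 : forall k, u k != 0) (w0 : forall k, w k != 0).
Hypothesis tu : forall k, t k * u k = 2 * s.
Hypothesis mw : forall k, m k * w k.+1 = - 2 * s.
Hypothesis wS : forall k, w k.+1 = w k - 2 * t k * d k + t k ^+ 2.
Hypothesis dS : forall k, d k.+1 = d k - t k + m k.
Hypothesis uS : forall k, u k.+1 = u k - 2 * m k * (d k - t k) - m k ^+ 2.

Let U := laxU _ (u 0).
Let V := laxV _ (- s) (d 0).
Let W := laxW _ (w 0).
Variable Q : {poly R}.
Hypotheses (Qmonic : Q \is monic) (sizeQ : size Q = 5) (Q0 : Q`_0 = 0).
Hypothesis laxQ : V ^+ 2 + U * W = (s ^+ 2)%:P * Q.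

(** Squaring [p1 + q1 sqrt Q] gives [p = 2 p1^2 - 1] and [q = 2 p1 q1 / s]. Then [p + q * lax] meets
    the conditions of [transfer_unique], and [p1^2 = 1] at the roots of [Q]. *)
Lemma pell_transfer M (p1 q1 : {poly R}) : size p1 = M.+3 -> size q1 = M.+1 ->
  p1 ^+ 2 - Q * q1 ^+ 2 = 1 ->
  exists p q, transfer _ t m M.+2.*2 = mx2 _ (p + q * V) (q * W) (q * U) (p - q * V)
    /\ forall x, root Q x -> p.[x] = 1.
Proof.
(* The sign of [q1] is free. With equal leading coefficients the top terms of [p] and [q * V] cancel
   in the upper left entry and reinforce each other in the lower right one. *)
wlog lpq : q1 / lead_coef q1 = lead_coef p1 => [hwlog|] sp1 sq1 pell.
  have p10 : p1 != 0 by rewrite -size_poly_gt0 sp1.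
  have q10 : q1 != 0 by rewrite -size_poly_gt0 sq1.
  have : lead_coef p1 ^+ 2 = lead_coef q1 ^+ 2.
    have pE : p1 ^+ 2 = Q * q1 ^+ 2 + 1 by rewrite -pell addrC subrK.
    rewrite -lead_coef_exp pE lead_coefDl.
      by rewrite lead_coef_monicM // lead_coef_exp.
    rewrite size_poly1 size_mul; [|exact: monic_neq0|by rewrite expf_neq0].
    rewrite sizeQ.
    have : (0 < size (q1 ^+ 2)%R)%N by rewrite size_poly_gt0 expf_neq0.
    by lia.
  move/eqP; rewrite eqf_sqr => /orP[/eqP e|/eqP e]; first exact: (hwlog q1).
  by apply: (hwlog (- q1)); rewrite ?lead_coefN ?size_polyN ?sqrrN.
pose l := lead_coef p1.
have l0 : l != 0 by rewrite lead_coef_eq0 -size_poly_gt0 sp1.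
pose p := 2 * p1 ^+ 2 - 1; pose q := (2 / s)%:P * (p1 * q1).
have ss : s%:P * (s^-1)%:P = 1 :> {poly R} by rewrite -polyCM mulfV.
have pq : p ^+ 2 - q ^+ 2 * ((s ^+ 2)%:P * Q) = 1.
  transitivity ((2 * p1 ^+ 2 - 1) ^+ 2 -
      4 * p1 ^+ 2 * ((s%:P * (s^-1)%:P) ^+ 2 * (Q * q1 ^+ 2))).
    by rewrite /p /q; ring.
  have -> : Q * q1 ^+ 2 = p1 ^+ 2 - 1 by rewrite -pell; ring.
  by rewrite ss; ring.
exists p, q; split; last first.
  move=> x /rootP Qx; have := congr1 (horner^~ x) pell.
  rewrite hornerD hornerN horner_exp hornerM Qx mul0r subr0 hornerC => e.
  by rewrite /p -[2]/(2%:R) -polyC_natr hornerD hornerN hornerM horner_exp !hornerC e; ring.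
have c2 (c : R) P i : (c%:P * P)`_i = c * P`_i by rewrite coefCM.
have szP := size_polyM_leqD R.
have sq : (size q <= (M.*2.+2).+1)%N.
  rewrite /q mul_polyC (leq_trans (size_scale_leq _ _)) //.
  have -> : (M.*2.+2 = M.+2 + M)%N by lia.
  by apply: szP; rewrite ?sp1 ?sq1.
have qtop : q`_(M.*2.+2) = 2 / s * l ^+ 2.
  rewrite /q c2; have -> : (M.*2.+2 = M.+2 + M)%N by lia.
  rewrite coefM_top ?sp1 ?sq1 // expr2; congr (_ * (_ * _)).
    by rewrite /l lead_coefE sp1.
  by rewrite /l -lpq lead_coefE sq1.
have sp : (size p <= (M.+2.*2).+1)%N.
  rewrite (leq_trans (size_polyD _ _)) // geq_max size_polyN size_poly1 /= andbT.
  have -> : (M.+2.*2 = 0 + (M.+2 + M.+2))%N by lia.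
  apply: (szP); last by rewrite expr2; apply: szP; rewrite sp1.
  by rewrite -[2]/(2%:R) -polyC_natr size_polyC_leq1.
have ptop : p`_(M.+2.*2) = 2 * l ^+ 2.
  rewrite /p coefB coef1 subr0 -[2]/(2%:R) -polyC_natr c2 expr2 -addnn.
  by rewrite coefM_top ?sp1 // /l lead_coefE sp1.
have sV : (size V <= 3)%N.
  apply/leq_sizeP => j j3; rewrite coefD !coefCM coefXn coefX.
  by case: j j3 => [|[|[|]]] // j _; rewrite !mulr0 addr0.
have Vtop : V`_2 = - s by rewrite coefD !coefCM coefXn coefX /= mulr1 mulr0 addr0.
have V0 : V`_0 = 0 by rewrite coefD !coefCM coefXn coefX /= !mulr0 addr0.
have sU : (size U <= 3)%N.
  apply/leq_sizeP => j j3; rewrite coefB !coefCM coefXn coefX.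
  by case: j j3 => [|[|[|]]] // j _; rewrite !mulr0 subr0.
have U0 : U`_0 = 0 by rewrite coefB !coefCM coefXn coefX /= !mulr0 subr0.
have sW : (size W <= 2)%N.
  apply/leq_sizeP => j j3; rewrite coefD coefCM coefX coef1.
  by case: j j3 => [|[|]] // j _; rewrite !mulr0 addr0.
have MM : (M.+2.*2 = M.*2.+2 + 2)%N by lia.
have sqV : (size (q * V)%R <= (M.+2.*2).+1)%N by rewrite MM; apply: szP.
have qVtop : (q * V)`_(M.+2.*2) = - (2 * l ^+ 2).
  by rewrite MM coefM_top // qtop Vtop; field.
apply: (transfer_unique R s u d w t m) => //.
- by rewrite /lax -/U -/V -/W !mul_mx2; congr mx2; ring.
- rewrite det_mx2; apply: (eq_of_sub_mul _ 1 _ _ _ _ pq).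
  by rewrite -laxQ; ring.
- rewrite /euclid_form !mxE /=; split.
  + rewrite (maxn_idPl _) //; apply: size_drop_top.
      by rewrite (leq_trans (size_polyD _ _)) // geq_max sp sqV.
    by rewrite coefD ptop qVtop subrr.
  + have -> : (M.+2.*2 = (M.*2.+2 + 1).+1)%N by lia.
    exact: szP.
  + by rewrite MM; apply: szP.
  + have s4 : (size (p - q * V)%R <= (M.+2.*2).+1)%N.
      by rewrite (leq_trans (size_polyD _ _)) // geq_max size_polyN sp sqV.
    apply/eqP; rewrite eqn_leq s4 ltnNge; apply/negP => s4'.
    have : (p - q * V)`_(M.+2.*2) = 0 by rewrite nth_default.
    rewrite coefB ptop qVtop opprK => /eqP; rewrite -mulr2n mulrn_eq0 mulf_eq0.
    by rewrite pnatr_eq0 expf_eq0 (negPf l0).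
- rewrite /unipotent_at0 !mxE /= (coefD p) (coefB p) !coef0M V0 U0 !mulr0 subr0 addr0.
  have p10 : p`_0 = 1.
    have := congr1 (fun P : {poly R} => P`_0) pell.
    rewrite coefB (coef0M Q) Q0 mul0r subr0 /p coefB -[2]/(2%:R) -polyC_natr c2 => ->.
    by rewrite coef1 /=; ring.
  by rewrite p10.
Qed.

End PellTransfer.

(** * Reflections in the ellipse *)

Section Ellipse.
Variables (R : realType) (a b beta : R).
Hypotheses (a0 : 0 < a) (b0 : 0 < b).
Implicit Types (A P v : R * R) (t : R).

Definition ell P v : R := b * P.1 * v.1 + a * P.2 * v.2.

Lemma boundaryE P : boundary a b P <-> ell P P = a * b.
Proof.
have a0n : a != 0 by rewrite gt_eqF.
have b0n : b != 0 by rewrite gt_eqF.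
rewrite /boundary /confocal /ell !subr0; split=> [e|e].
  by rewrite -[RHS]mulr1 -e; field; rewrite a0n b0n.
apply: (mulfI (mulf_neq0 a0n b0n)); rewrite mulr1 -[RHS]e; field.
by rewrite a0n b0n.
Qed.

Lemma tableE P : table a b P <-> ell P P <= a * b.
Proof.
rewrite /table /ell -(ler_pM2l (mulr_gt0 a0 b0)) mulr1.
suff -> : a * b * (P.1 ^+ 2 / a + P.2 ^+ 2 / b) = b * P.1 * P.1 + a * P.2 * P.2 by [].
by field; rewrite !gt_eqF.
Qed.

Lemma ell_move P v t : ell (move P v t) (move P v t) =
  ell P P + 2 * t * ell P v + t ^+ 2 * ell v v.
Proof. by rewrite /ell /move /=; ring. Qed.

Lemma ell_gt0 v : v != (0, 0) -> 0 < ell v v.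
Proof.
case: v => x y; rewrite xpair_eqE negb_and /ell /= => xy.
have ea : 0 <= b * x * x by rewrite -mulrA mulr_ge0 ?(ltW b0) // -expr2 sqr_ge0.
have eb : 0 <= a * y * y by rewrite -mulrA mulr_ge0 ?(ltW a0) // -expr2 sqr_ge0.
case/orP: xy => [x0|y0].
  by rewrite ltr_wpDr // -mulrA mulr_gt0 // -expr2 lt_def sqr_ge0 andbT expf_eq0.
by rewrite ltr_wpDl // -mulrA mulr_gt0 // -expr2 lt_def sqr_ge0 andbT expf_eq0.
Qed.

(** Two distinct times would be the roots of a quadratic with positive leading coefficient; their
    product is positive, but the constant term is not, [P] being in the table. *)
Lemma exit_time_unique P v t1 t2 : v != (0, 0) -> table a b P ->
  0 < t1 -> 0 < t2 -> boundary a b (move P v t1) -> boundary a b (move P v t2) ->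
  t1 = t2.
Proof.
move=> /ell_gt0 v0 /tableE PT t10 t20 /boundaryE B1 /boundaryE B2.
rewrite ell_move in B1; rewrite ell_move in B2.
apply/eqP; apply: contraT => t12.
have e : 2 * ell P v = - ell v v * (t1 + t2).
  have t12' : t1 - t2 != 0 by rewrite subr_eq0.
  apply: (mulfI t12'); apply: (eq_of_sub_mul _ 1 _ _ _ _ (etrans B1 (esym B2))); ring.
have : 0 < ell v v * (t1 * t2) by rewrite !mulr_gt0.
have : ell P P - a * b = ell v v * (t1 * t2).
  apply: (eq_of_sub_mul _ 1 _ _ _ _ B1).
  rewrite (_ : 2 * t1 * _ = t1 * (2 * ell P v)); last by ring.
  by rewrite e; ring.
by have := PT; lra.
Qed.

Lemma chord_length P v t : t != 0 -> boundary a b P ->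
  boundary a b (move P v t) -> t * ell v v = - 2 * ell P v.
Proof.
move=> t0 /boundaryE BP /boundaryE; rewrite ell_move BP => B.
apply: (mulfI t0); apply: (eq_of_sub_mul _ 1 _ _ _ _ B); ring.
Qed.

(** On the ellipse, [- gap P] is [a * b] times the squared length of the normal vector; [gap] is the
    entry [w] of [lax]. *)
Definition gap P : R := P.1 ^+ 2 + P.2 ^+ 2 - a - b.

Lemma gap_lt0 P : b <= a -> boundary a b P -> gap P < 0.
Proof.
move=> ba /boundaryE B; rewrite -(pmulr_rlt0 _ b0) /gap.
have : 0 <= (a - b) * P.2 ^+ 2 by rewrite mulr_ge0 ?sqr_ge0 // subr_ge0.
have : 0 < b ^+ 2 by rewrite exprn_gt0.
by move: B; rewrite /ell; lra.
Qed.

Lemma normal_gap P : boundary a b P ->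
  dot (normal_at a b P) (normal_at a b P) * (a * b) = - gap P.
Proof.
move=> /boundaryE; rewrite /ell /dot /normal_at /gap /= => B.
have -> : P.1 / a * (P.1 / a) + P.2 / b * (P.2 / b) =
   (b ^+ 2 * P.1 ^+ 2 + a ^+ 2 * P.2 ^+ 2) / (a * b) ^+ 2.
  by field; rewrite !gt_eqF.
apply: (eq_of_sub_mul _ ((a + b) / (a * b)) _ _ _ _ B).
by field; rewrite !gt_eqF.
Qed.

Lemma dot_normal P v : dot v (normal_at a b P) * (a * b) = ell P v.
Proof. by rewrite /dot /normal_at /ell /=; field; rewrite !gt_eqF. Qed.

Definition bounce_coef P v : R :=
  2 * dot v (normal_at a b P) / dot (normal_at a b P) (normal_at a b P).

Lemma reflectE P v : reflect_at a b P v =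
  (v.1 - bounce_coef P v * (P.1 / a), v.2 - bounce_coef P v * (P.2 / b)).
Proof. by rewrite /reflect_at /move /= !mulNr. Qed.

(** The counterpart of [chord_length] for reflections; it supplies the hypothesis of
    [bounce_lax]. *)
Lemma bounce_gap P v : b <= a -> boundary a b P ->
  bounce_coef P v * gap P = - 2 * ell P v.
Proof.
move=> ba B; have g := gap_lt0 _ ba B; have n := normal_gap _ B.
have n0 : dot (normal_at a b P) (normal_at a b P) != 0.
  by apply: contraTneq g => n0; rewrite -[gap P]opprK -n n0 mul0r oppr0 ltxx.
rewrite -[gap P]opprK -n -dot_normal /bounce_coef; field.
by [].
Qed.

Lemma dot_reflect P v : b <= a -> boundary a b P ->
  dot (reflect_at a b P v) (reflect_at a b P v) = dot v v.
Proof.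
move=> ba B; have g := gap_lt0 _ ba B.
have mg := bounce_gap _ v ba B; have n := normal_gap _ B; have e := dot_normal P v.
have ab0 : a * b != 0 by rewrite mulf_neq0 // gt_eqF.
rewrite reflectE; move: (bounce_coef P v) mg => m mg.
apply: (mulfI ab0).
transitivity (a * b * dot v v - 2 * m * (dot v (normal_at a b P) * (a * b)) +
   m ^+ 2 * (dot (normal_at a b P) (normal_at a b P) * (a * b))).
  by rewrite /dot /normal_at /=; ring.
rewrite n e; apply: (eq_of_sub_mul _ (- m) _ _ _ _ mg); ring.
Qed.

Lemma reflectK P v : b <= a -> boundary a b P ->
  reflect_at a b P (reflect_at a b P v) = v.
Proof.
move=> ba B; have g := gap_lt0 _ ba B.
have mg := bounce_gap _ v ba B; have mg' := bounce_gap _ (reflect_at a b P v) ba B.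
have g0 : gap P != 0 by rewrite lt_eqF.
have mm : bounce_coef P (reflect_at a b P v) = - bounce_coef P v.
  apply: (mulIf g0); rewrite mg' [- bounce_coef _ _ * _]mulNr mg -!dot_normal.
  have n := normal_gap _ B.
  rewrite reflectE; move: (bounce_coef P v) mg => m mg.
  have -> : dot (v.1 - m * (P.1 / a), v.2 - m * (P.2 / b)) (normal_at a b P) * (a * b) =
    dot v (normal_at a b P) * (a * b) -
    m * (dot (normal_at a b P) (normal_at a b P) * (a * b)).
    by rewrite /dot /normal_at /=; ring.
  rewrite n dot_normal; apply: (eq_of_sub_mul _ (- 2) _ _ _ _ mg); ring.
rewrite [LHS]reflectE mm reflectE /=; case: v {mg mg' mm} => x y /=.
by congr pair; ring.
Qed.

Lemma gap_move P v t : dot v v = 1 ->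
  gap (move P v t) = gap P + 2 * t * dot P v + t ^+ 2.
Proof.
move=> v1; apply: (eq_of_sub_mul _ (t ^+ 2) _ _ _ _ v1).
by rewrite /gap /move /dot /=; ring.
Qed.

Lemma dot_move P v t : dot v v = 1 -> dot (move P v t) v = dot P v + t.
Proof.
move=> v1; apply: (eq_of_sub_mul _ t _ _ _ _ v1).
by rewrite /dot /move /=; ring.
Qed.

Lemma dot_reflect_pos P v : boundary a b P ->
  dot P (reflect_at a b P v) = dot P v - bounce_coef P v.
Proof.
rewrite reflectE /boundary /confocal !subr0 /dot /=.
move: (bounce_coef P v) => m B.
apply: (eq_of_sub_mul _ (- m) _ _ _ _ B); ring.
Qed.

Lemma ell_reflect P v : b <= a -> boundary a b P ->
  ell (reflect_at a b P v) (reflect_at a b P v) =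
  ell v v + 2 * bounce_coef P v * dot P v - bounce_coef P v ^+ 2.
Proof.
move=> ba B; have mg := bounce_gap _ v ba B.
have n := normal_gap _ B; have e := dot_normal P v.
move: B; rewrite /boundary /confocal !subr0 reflectE.
move: (bounce_coef P v) mg => m mg B.
have ab0 : a * b != 0 by rewrite mulf_neq0 // gt_eqF.
have N0 : - 2 * dot v (normal_at a b P) +
    m * dot (normal_at a b P) (normal_at a b P) = 0.
  apply: (mulIf ab0); rewrite mul0r mulrDl -!mulrA n e.
  by apply: (eq_of_sub_mul _ (- 1) _ _ _ _ mg); ring.
(* The summand with factor [a + b] vanishes by [N0]; once it is added, the first equality is an
   identity of rational functions. *)
transitivity (ell v v + 2 * m * dot P v - m ^+ 2 * (P.1 ^+ 2 / a + P.2 ^+ 2 / b) +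
   (a + b) * m * (- 2 * dot v (normal_at a b P) +
    m * dot (normal_at a b P) (normal_at a b P))); last by rewrite N0 B; ring.
rewrite /ell /dot /normal_at /=; field.
by rewrite !gt_eqF.
Qed.

(** This is the dual conic: [(X / (a - beta), Y / (b - beta))] is orthogonal to [v], hence
    proportional to [(v.2, - v.1)], which eliminates the point of tangency. *)
Lemma caustic_eq P v : a != beta -> b != beta -> tangent_to_confocal a b beta P v ->
  (a - beta) * v.2 ^+ 2 + (b - beta) * v.1 ^+ 2 = (P.1 * v.2 - P.2 * v.1) ^+ 2.
Proof.
move=> anb bnb [X [Y [Z [nz conic line]]]].
have ab0 : a - beta != 0 by rewrite subr_eq0.
have bb0 : b - beta != 0 by rewrite subr_eq0.
have e0 := line 0; have e1 := line 1; rewrite /move /= !mul0r !addr0 !mul1r in e0 e1.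
move: nz conic e0 e1; case: v {line} => vx vy; case: P => Px Py /=.
have -> : X = X / (a - beta) * (a - beta) by rewrite divfK.
have -> : Y = Y / (b - beta) * (b - beta) by rewrite divfK.
move: (X / (a - beta)) (Y / (b - beta)) => x y nz.
have -> : (x * (a - beta)) ^+ 2 / (a - beta) + (y * (b - beta)) ^+ 2 / (b - beta) =
   x ^+ 2 * (a - beta) + y ^+ 2 * (b - beta) by field; rewrite ab0 bb0.
have -> : x * (a - beta) * Px / (a - beta) + y * (b - beta) * Py / (b - beta) =
   x * Px + y * Py by field; rewrite ab0 bb0.
have -> : x * (a - beta) * (Px + vx) / (a - beta) + y * (b - beta) * (Py + vy) / (b - beta) =
   x * Px + y * Py + (x * vx + y * vy) by field; rewrite ab0 bb0.
move=> conic e0; rewrite e0 => /eqP.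
rewrite -subr_eq0 [_ + _ - _]addrC addrA addNr add0r => /eqP xyv.
have [x0|x0] := eqVneq x 0; last first.
  apply: (mulfI (expf_neq0 2 x0)).
  have vxE : x * vx = - (y * vy) by apply/eqP; rewrite -addr_eq0 xyv.
  transitivity ((a - beta) * (x * vy) ^+ 2 + (b - beta) * (x * vx) ^+ 2); first by ring.
  transitivity ((x * Px * vy - Py * (x * vx)) ^+ 2); last by ring.
  rewrite vxE; transitivity (vy ^+ 2 * (x ^+ 2 * (a - beta) + y ^+ 2 * (b - beta))).
    by ring.
  by rewrite conic -e0; ring.
(* With [x = y = 0] the coordinate [Z] would vanish too. *)
have y0 : y != 0.
  apply: contra_notN nz => /eqP y0; rewrite -e0 x0 y0 !mul0r addr0.
  by [].
apply: (mulfI (expf_neq0 2 y0)).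
have vyE : y * vy = - (x * vx) by apply/eqP; rewrite -addr_eq0 addrC xyv.
transitivity ((a - beta) * (y * vy) ^+ 2 + (b - beta) * (y * vx) ^+ 2); first by ring.
transitivity ((Px * (y * vy) - y * Py * vx) ^+ 2); last by ring.
rewrite vyE; transitivity (vx ^+ 2 * (x ^+ 2 * (a - beta) + y ^+ 2 * (b - beta))).
  by ring.
by rewrite conic -e0; ring.
Qed.

(* Lagrange's identity for the vectors [(sqrt b P.1, sqrt a P.2)] and
   [(sqrt b v.1, sqrt a v.2)]. *)
Lemma ell_sqr P v : dot v v = 1 -> boundary a b P ->
  (a - beta) * v.2 ^+ 2 + (b - beta) * v.1 ^+ 2 = (P.1 * v.2 - P.2 * v.1) ^+ 2 ->
  ell P v ^+ 2 = a * b * beta.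
Proof.
move=> v1 /boundaryE BP tang.
have -> : ell P v ^+ 2 = ell v v * ell P P - a * b * (P.1 * v.2 - P.2 * v.1) ^+ 2.
  by rewrite /ell; ring.
rewrite BP -tang; apply: (eq_of_sub_mul _ (a * b * beta) _ _ _ _ v1).
by rewrite /ell /dot; ring.
Qed.

(** The coefficients are the symmetric functions of [a], [b], [beta]: [k1] is their sum, [k2] the
    sum of the pairwise products up to sign, and [ell_sqr] gives the product. *)
Lemma lax_ellipse s P v : dot v v = 1 -> boundary a b P -> ell P v = - s ->
  (a - beta) * v.2 ^+ 2 + (b - beta) * v.1 ^+ 2 = (P.1 * v.2 - P.2 * v.1) ^+ 2 ->
  laxV _ (- s) (- dot P v) ^+ 2 + laxU _ (ell v v) * laxW _ (gap P) =
  'X * (a%:P * 'X - 1) * (b%:P * 'X - 1) * (beta%:P * 'X - 1).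
Proof.
move=> v1 BP es tang; have s2 := ell_sqr P v v1 BP tang; rewrite es sqrrN in s2.
move/boundaryE: BP => BP.
have c2 : (P.1 * v.2 - P.2 * v.1) ^+ 2 = ell v v - beta.
  rewrite -tang; apply: (eq_of_sub_mul _ (- beta) _ _ _ _ v1).
  by rewrite /ell /dot; ring.
have k1 : dot P v ^+ 2 + ell v v - gap P = a + b + beta.
  have -> : beta = ell v v - (P.1 * v.2 - P.2 * v.1) ^+ 2 by rewrite c2; ring.
  apply: (eq_of_sub_mul _ (P.1 ^+ 2 + P.2 ^+ 2) _ _ _ _ v1).
  by rewrite /dot /gap; ring.
have k2 : ell v v * gap P + 2 * s * dot P v = - (a * b + a * beta + b * beta).
  have -> : s = - ell P v by rewrite es opprK.
  have bE : beta = ell v v - (P.1 * v.2 - P.2 * v.1) ^+ 2 by rewrite c2; ring.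
  transitivity ((a + b) * (P.1 * v.2 - P.2 * v.1) ^+ 2 - ell P P * dot v v - (a + b) * ell v v).
    by rewrite /ell /dot /gap; ring.
  by rewrite BP v1 c2; ring.
have k1P := congr1 polyC k1; have k2P := congr1 polyC k2; have s2P := congr1 polyC s2.
transitivity ('X * ((s ^+ 2)%:P * 'X^3 + (ell v v * gap P + 2 * s * dot P v)%:P * 'X^2 +
   (dot P v ^+ 2 + ell v v - gap P)%:P * 'X - 1)).
  by rewrite /laxV /laxU /laxW; ring.
by rewrite k1P k2P s2P; ring.
Qed.


Lemma lax_horner P v r : [/\
  (laxV _ (ell P v) (- dot P v)).[r] = ell P v * r ^+ 2 - dot P v * r,
  (laxU _ (ell v v)).[r] = ell v v * r ^+ 2 - r &
  (laxW _ (gap P)).[r] = 1 + gap P * r].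
Proof.
by split; rewrite /laxV /laxU /laxW !(hornerD, hornerN, hornerM, hornerC, hornerXn, hornerX) ?mulNr.
Qed.

(** The column [(P.1, v.1)] lies in the kernel of [lax] at [1/a], so [p + q * lax] acts on it as the
    number [p.[a^-1]]. *)
Lemma lax_kernel_x P v (V := laxV _ (ell P v) (- dot P v)) :
  boundary a b P -> dot v v = 1 ->
  V.[a^-1] * P.1 + (laxW _ (gap P)).[a^-1] * v.1 = 0 /\
  (laxU _ (ell v v)).[a^-1] * P.1 - V.[a^-1] * v.1 = 0.
Proof.
move=> /boundaryE B v1; have [-> -> ->] := lax_horner P v a^-1.
have a0n : a != 0 by rewrite gt_eqF.
split.
- apply: (eq_of_sub_mul _ (v.1 / a ^+ 2) _ _ _ _ B).
  by rewrite /ell /dot /gap; field.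
- apply: (eq_of_sub_mul _ (P.1 / a) _ _ _ _ v1).
  by rewrite /ell /dot; field.
Qed.

Lemma lax_kernel_y P v (V := laxV _ (ell P v) (- dot P v)) :
  boundary a b P -> dot v v = 1 ->
  V.[b^-1] * P.2 + (laxW _ (gap P)).[b^-1] * v.2 = 0 /\
  (laxU _ (ell v v)).[b^-1] * P.2 - V.[b^-1] * v.2 = 0.
Proof.
move=> /boundaryE B v1; have [-> -> ->] := lax_horner P v b^-1.
have b0n : b != 0 by rewrite gt_eqF.
split.
- apply: (eq_of_sub_mul _ (v.2 / b ^+ 2) _ _ _ _ B).
  by rewrite /ell /dot /gap; field.
- apply: (eq_of_sub_mul _ (P.2 / b) _ _ _ _ v1).
  by rewrite /ell /dot; field.
Qed.

End Ellipse.

(** * Periodic trajectories *)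

(** [e] is the sign that the flip gives to the coordinate, and [r] is the matching factor [1/a] or
    [1/b] of the normal. *)
Lemma transfer_action (R : realFieldType) (t m x y : nat -> R) (e r : R) :
  (forall k, x k.+1 = e * (x k + t k * y k)) ->
  (forall k, y k.+1 = e * (y k - m k * ((x k + t k * y k) * r))) ->
  forall k (M := transfer _ t m k),
    x k = e ^+ k * ((M 0 0).[r] * x 0%N + (M 0 1).[r] * y 0%N) /\
    y k = e ^+ k * ((M 1 0).[r] * x 0%N + (M 1 1).[r] * y 0%N).
Proof.
move=> xS yS; elim=> [|k [IHx IHy]] /=.
  by rewrite mx2_1 !mxE /= !hornerE; split.
rewrite [transfer _ t m k]mx2_eta -mulmxA !mul_mx2 !mxE /=.
rewrite !(mul1r, mul0r, add0r, addr0) xS yS IHx IHy.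
rewrite !(hornerD, hornerM, hornerN, hornerC, hornerX, exprS).
by split; ring.
Qed.

(** * Trajectories with a given caustic *)

Section Trajectory.
Variables (R : realType) (a b beta : R).
Variables (P v : nat -> R * R) (tau : nat -> R).
Hypotheses (hb : 0 < b) (hab : b < a) (hbeta : 0 < beta < b \/ b < beta < a).
Hypothesis htraj : magic_trajectory a b P v tau.
Hypothesis hcaustic : has_caustic a b P v beta.

Let ha : 0 < a. Proof. exact: lt_trans hab. Qed.
Let hab' : b <= a. Proof. exact: ltW. Qed.
Let hbeta0 : 0 < beta.
Proof. by case: hbeta => /andP[? ?] //; apply: lt_trans hb _. Qed.
Let anbeta : a != beta.
Proof.
by case: hbeta => /andP[h1 h2]; rewrite gt_eqF //; apply: lt_trans hab.
Qed.
Let bnbeta : b != beta.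
Proof. by case: hbeta => /andP[h1 h2]; rewrite ?(gt_eqF h2) ?(lt_eqF h1). Qed.

Local Notation form := (ell R a b).
Local Notation defect := (gap R a b).
Let hit k := move (P k) (v k) (tau k).
Let s := Num.sqrt (a * b * beta).

Lemma flipK : involutive (@flip R).
Proof. by case=> x y; rewrite /flip /= opprK. Qed.

Lemma flip_inj : injective (@flip R).
Proof. exact: inv_inj flipK. Qed.

Lemma dot_flip (u w : R * R) : dot (flip u) (flip w) = dot u w.
Proof. by rewrite /dot /= mulrNN. Qed.

Lemma ell_flip (u w : R * R) : form (flip u) (flip w) = form u w.
Proof. by rewrite /ell /flip /=; ring. Qed.

Lemma gap_flip (u : R * R) : defect (flip u) = defect u.
Proof. by rewrite /gap /= sqrrN. Qed.

Lemma boundary_flip (u : R * R) : boundary a b (flip u) <-> boundary a b u.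
Proof. by rewrite /boundary /confocal /= sqrrN. Qed.

Lemma tau_gt0 k : 0 < tau k.
Proof. by have [_ _ /(_ k)[]] := htraj. Qed.

Lemma hit_boundary k : boundary a b (hit k).
Proof. by have [_ _ /(_ k)[]] := htraj. Qed.

Lemma posS k : P k.+1 = flip (hit k).
Proof. by have [_ _ /(_ k)[]] := htraj. Qed.

Lemma velS k : v k.+1 = flip (reflect_at a b (hit k) (v k)).
Proof. by have [_ _ /(_ k)[]] := htraj. Qed.

Lemma pos_boundary k : boundary a b (P k.+1).
Proof. by rewrite posS; apply/boundary_flip/hit_boundary. Qed.

Lemma vel_unit k : dot (v k) (v k) = 1.
Proof.
elim: k => [|k IH]; first by have [_ ->] := htraj.
by rewrite velS dot_flip dot_reflect //; exact: hit_boundary.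
Qed.

Lemma vel_neq0 k : v k != (0, 0).
Proof.
apply/eqP => v0; have := vel_unit k; rewrite v0 /dot /= !mul0r addr0 => /eqP.
by rewrite eq_sym oner_eq0.
Qed.

Lemma s_gt0 : 0 < s.
Proof. by rewrite sqrtr_gt0 !mulr_gt0. Qed.

Lemma s_sqr : s ^+ 2 = a * b * beta.
Proof. by rewrite sqr_sqrtr // ltW // !mulr_gt0. Qed.

Lemma tangent_line k : (a - beta) * (v k).2 ^+ 2 + (b - beta) * (v k).1 ^+ 2 =
  ((P k).1 * (v k).2 - (P k).2 * (v k).1) ^+ 2.
Proof. exact: caustic_eq (hcaustic k). Qed.

Lemma chord k : tau k.+1 * form (v k.+1) (v k.+1) = - 2 * form (P k.+1) (v k.+1).
Proof.
by apply: chord_length; rewrite ?gt_eqF ?tau_gt0 //; [exact: pos_boundary|exact: hit_boundary].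
Qed.

(** Tangency fixes the square; the sign follows from the positive flight time along the next
    chord. *)
Lemma ell_pos k : form (P k.+1) (v k.+1) = - s.
Proof.
have : form (P k.+1) (v k.+1) ^+ 2 = s ^+ 2.
  rewrite s_sqr; apply: ell_sqr (vel_unit _) (pos_boundary _) (tangent_line _) => //.
move/eqP; rewrite eqf_sqr => /orP[] /eqP // e.
have : 0 < tau k.+1 * form (v k.+1) (v k.+1).
  by rewrite mulr_gt0 ?tau_gt0 // ell_gt0 // vel_neq0.
by rewrite chord e; have := s_gt0; lra.
Qed.

Lemma ell_hit k : form (hit k.+1) (v k.+1) = s.
Proof.
transitivity (form (P k.+1) (v k.+1) + tau k.+1 * form (v k.+1) (v k.+1)).
  by rewrite /ell /hit /move /=; ring.
by rewrite chord ell_pos; ring.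
Qed.

(** The chain starts at state 1, because [P 0] may lie inside the table. *)
Let t k := tau k.+1.
Let m k := bounce_coef _ a b (hit k.+1) (v k.+1).
Let u k := form (v k.+1) (v k.+1).
Let d k := - dot (P k.+1) (v k.+1).
Let w k := defect (P k.+1).

Lemma chain_u0 k : u k != 0.
Proof. by rewrite gt_eqF // ell_gt0 // vel_neq0. Qed.

Lemma chain_w0 k : w k != 0.
Proof. by rewrite lt_eqF // gap_lt0 //; exact: pos_boundary. Qed.

Lemma chain_tu k : t k * u k = 2 * s.
Proof. by rewrite /t /u chord ell_pos; ring. Qed.

Lemma chain_mw k : m k * w k.+1 = - 2 * s.
Proof.
rewrite /m /w posS gap_flip bounce_gap //; last exact: hit_boundary.
by rewrite ell_hit.
Qed.

Lemma chain_wS k : w k.+1 = w k - 2 * t k * d k + t k ^+ 2.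
Proof.
by rewrite /w posS gap_flip gap_move ?vel_unit // /t /d; ring.
Qed.

Lemma chain_dS k : d k.+1 = d k - t k + m k.
Proof.
rewrite /d posS velS dot_flip dot_reflect_pos; last exact: hit_boundary.
by rewrite /hit dot_move ?vel_unit // /m /t; ring.
Qed.

Lemma chain_uS k : u k.+1 = u k - 2 * m k * (d k - t k) - m k ^+ 2.
Proof.
rewrite /u velS ell_flip ell_reflect //; last exact: hit_boundary.
by rewrite -/(m k) /hit dot_move ?vel_unit // /d /t; ring.
Qed.

Lemma return_mapP n : (0 < n)%N ->
  n_periodic P v tau n <-> P n.+1 = P 1%N /\ v n.+1 = v 1%N.
Proof.
case: n => // n _; split.
- move=> [vn [r [/andP[r0 rtau] P0]]].
  have hits : hit n.+1 = hit 0%N.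
    (* After time [r] the particle is at [P 0] with velocity [v 0]; what remains of the flight is an
       exit time from there. *)
    have e : tau n.+1 - r = tau 0%N.
      have [tab _ _] := htraj.
      apply: (exit_time_unique _ _ _ ha hb (P 0%N) (v 0%N)) => //.
      + exact: vel_neq0.
      + by rewrite subr_gt0.
      + exact: tau_gt0.
      + have -> : move (P 0%N) (v 0%N) (tau n.+1 - r) = hit n.+1.
          by rewrite P0 /hit vn /move /=; congr pair; ring.
        exact: hit_boundary.
      + exact: hit_boundary.
    by rewrite /hit P0 -e vn /move /=; congr pair; ring.
  by rewrite posS velS hits vn -posS -velS.
- rewrite (posS n.+1) (posS 0) (velS n.+1) (velS 0) => -[/flip_inj hits /flip_inj].
  rewrite hits => vs.
  (* Reflection is an involution, so equal velocities after the common hit come from equal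
     velocities before it. *)
  have vn : v n.+1 = v 0%N.
    have B := hit_boundary 0.
    by rewrite -(reflectK _ _ _ ha hb _ (v n.+1) hab' B) vs reflectK.
  split=> //; exists (tau n.+1 - tau 0%N).
  have PE : P 0%N = move (P n.+1) (v n.+1) (tau n.+1 - tau 0%N).
    move: hits; rewrite /hit vn /move => -[e1 e2].
    rewrite [LHS]surjective_pairing; congr pair.
      by apply: (eq_of_sub_mul _ (-1) _ _ _ _ e1); ring.
    by apply: (eq_of_sub_mul _ (-1) _ _ _ _ e2); ring.
  (* [P 0] is in the table, so it cannot lie behind the boundary point [P n.+1] on their common
     line; this gives the sign of the time difference. *)
  split=> //; rewrite subr_ge0 gtrBl tau_gt0 andbT.
  have [/tableE - /(_ ha hb) tab _ _] := htraj.
  move: tab; rewrite PE ell_move.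
  have /boundaryE -/(_ ha hb) -> := pos_boundary n.
  have ch := chord n; have u0 := ell_gt0 _ _ _ ha hb _ (vel_neq0 n.+1).
  set x := tau n.+1 - tau 0%N => le.
  have : x * form (v n.+1) (v n.+1) * (x - tau n.+1) <= 0.
    rewrite mulrBr -[_ * _ * tau n.+1]mulrA [_ * tau n.+1]mulrC ch.
    by move: le; lra.
  have -> : x - tau n.+1 = - tau 0%N by rewrite /x; ring.
  rewrite mulrN oppr_le0 pmulr_lge0 ?tau_gt0 //.
  by rewrite pmulr_lge0 // subr_ge0.
Qed.

Let Q : {poly R} :=
  'X * ('X - (a^-1)%:P) * ('X - (b^-1)%:P) * ('X - (beta^-1)%:P).

Lemma prod_rootsE : Q = \prod_(x <- [:: 0; a^-1; b^-1; beta^-1]) ('X - x%:P).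
Proof. by rewrite !big_cons big_nil mulr1 polyC0 subr0 !mulrA. Qed.

Lemma uniq_roots4 : uniq [:: 0; a^-1; b^-1; beta^-1].
Proof.
rewrite /= !inE !negb_or ![0 == _]eq_sym !invr_eq0 !(inj_eq invr_inj) anbeta bnbeta.
by rewrite (gt_eqF ha) (gt_eqF hb) (gt_eqF hbeta0) (gt_eqF hab).
Qed.

Lemma size_Q : size Q = 5%N.
Proof. by rewrite prod_rootsE (size_prod_XsubC _ id). Qed.

Lemma Q_monic : Q \is monic.
Proof. by rewrite prod_rootsE monic_prod_XsubC. Qed.

Lemma Q_separable : coprimep Q Q^`().
Proof.
have : separable_poly Q by rewrite prod_rootsE separable_prod_XsubC uniq_roots4.
by rewrite unlock.
Qed.

Lemma root_Q x : x \in [:: 0; a^-1; b^-1; beta^-1] -> root Q x.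
Proof. by rewrite prod_rootsE root_prod_XsubC. Qed.

Lemma Q_coef0 : Q`_0 = 0.
Proof. by apply/eqP; rewrite -horner_coef0 -/(root Q 0) root_Q // inE eqxx. Qed.

Lemma Q_coef1 : Q`_1 != 0.
Proof.
have Q00 : root Q 0 by rewrite root_Q // inE eqxx.
by have := coprimep_root Q_separable Q00; rewrite horner_coef0 coef_deriv mulr1n.
Qed.

Lemma factorsE :
  'X * (a%:P * 'X - 1) * (b%:P * 'X - 1) * (beta%:P * 'X - 1) = (s ^+ 2)%:P * Q.
Proof.
have inv (x : R) : 0 < x -> x%:P * 'X - 1 = x%:P * ('X - (x^-1)%:P).
  by move=> x0; rewrite mulrBr -polyCM mulfV // gt_eqF.
by rewrite s_sqr !inv // /Q !polyCM; ring.
Qed.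

Local Notation V := (laxV R (- s) (d 0)).
Local Notation U := (laxU R (u 0)).
Local Notation W := (laxW R (w 0)).

Lemma lax_Q : V ^+ 2 + U * W = (s ^+ 2)%:P * Q.
Proof.
rewrite -factorsE; apply: lax_ellipse (vel_unit _) (pos_boundary _) (ell_pos _) (tangent_line _) => //.
Qed.

Let M n := transfer R t m n.

Lemma transfer_orbit n p q :
  M n = mx2 _ (p + q * V) (q * W) (q * U) (p - q * V) ->
  [/\ (P n.+1).1 = (- 1) ^+ n * p.[a^-1] * (P 1%N).1,
      (v n.+1).1 = (- 1) ^+ n * p.[a^-1] * (v 1%N).1,
      (P n.+1).2 = p.[b^-1] * (P 1%N).2 &
      (v n.+1).2 = p.[b^-1] * (v 1%N).2].
Proof.
move=> ME.
have xS k : (P k.+2).1 = - 1 * ((P k.+1).1 + t k * (v k.+1).1).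
  by rewrite posS mulN1r.
have yS k : (v k.+2).1 =
    - 1 * ((v k.+1).1 - m k * (((P k.+1).1 + t k * (v k.+1).1) * a^-1)).
  by rewrite velS reflectE /= mulN1r.
have xS' k : (P k.+2).2 = 1 * ((P k.+1).2 + t k * (v k.+1).2).
  by rewrite posS mul1r.
have yS' k : (v k.+2).2 =
    1 * ((v k.+1).2 - m k * (((P k.+1).2 + t k * (v k.+1).2) * b^-1)).
  by rewrite velS reflectE /= mul1r.
have [e1 e2] := transfer_action _ t m (fun k => (P k.+1).1) (fun k => (v k.+1).1) _ _ xS yS n.
have [e3 e4] := transfer_action _ t m (fun k => (P k.+1).2) (fun k => (v k.+1).2) _ _ xS' yS' n.
have [k1 k2] := lax_kernel_x _ _ _ ha hb _ _ (pos_boundary 0) (vel_unit 1).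
have [k3 k4] := lax_kernel_y _ _ _ ha hb _ _ (pos_boundary 0) (vel_unit 1).
rewrite ell_pos in k1 k2 k3 k4.
rewrite -/(M n) ME !mxE /= in e1 e2 e3 e4.
rewrite !(hornerD, hornerN, hornerM) in e1 e2 e3 e4 k1 k2 k3 k4.
split.
- rewrite e1.
  apply: (eq_of_sub_mul _ ((-1) ^+ n * q.[a^-1]) _ _ _ _ k1); rewrite /d /w; ring.
- rewrite e2.
  apply: (eq_of_sub_mul _ ((-1) ^+ n * q.[a^-1]) _ _ _ _ k2); rewrite /d /u; ring.
- rewrite e3 expr1n.
  apply: (eq_of_sub_mul _ q.[b^-1] _ _ _ _ k3); rewrite /d /w; ring.
- rewrite e4 expr1n.
  apply: (eq_of_sub_mul _ q.[b^-1] _ _ _ _ k4); rewrite /d /u; ring.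
Qed.

(** Otherwise the line of motion is the axis [x = 0], whose tangency to the caustic forces
    [beta = a]. *)
Lemma pos_vel1_neq0 : ((P 1%N).1 != 0) || ((v 1%N).1 != 0).
Proof.
rewrite -negb_and; apply/negP => /andP[/eqP x0 /eqP y0].
have tl := tangent_line 1; have vu := vel_unit 1; rewrite /dot x0 y0 in tl vu.
suff : a - beta = 0 by move=> /eqP; rewrite subr_eq0 (negPf anbeta).
rewrite -[LHS]mulr1 -[X in _ * X = _]vu.
by apply: (eq_of_sub_mul _ 1 _ _ _ _ tl); ring.
Qed.

Lemma pos_vel2_neq0 : ((P 1%N).2 != 0) || ((v 1%N).2 != 0).
Proof.
rewrite -negb_and; apply/negP => /andP[/eqP x0 /eqP y0].
have tl := tangent_line 1; have vu := vel_unit 1; rewrite /dot x0 y0 in tl vu.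
suff : b - beta = 0 by move=> /eqP; rewrite subr_eq0 (negPf bnbeta).
rewrite -[LHS]mulr1 -[X in _ * X = _]vu.
by apply: (eq_of_sub_mul _ 1 _ _ _ _ tl); ring.
Qed.

Lemma periodic_pell n : (0 < n)%N -> n_periodic P v tau n ->
  ~~ odd n /\ pell_condition a b beta n./2.
Proof.
move=> n0 /(return_mapP _ n0)[Pn vn].
have com : M n *m lax R (u 0) (- s) (d 0) (w 0) = lax R (u 0) (- s) (d 0) (w 0) *m M n.
  have := transfer_lax _ s u d w t m chain_tu chain_mw chain_wS chain_dS chain_uS n.
  by rewrite /u /d /w Pn vn.
have s2 : s ^+ 2 != 0 by rewrite expf_neq0 // gt_eqF // s_gt0.
have sqfree r : root (V ^+ 2 + U * W) r -> ~~ root (V ^+ 2 + U * W)^`() r.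
  rewrite lax_Q mul_polyC derivZ !rootZ //.
  exact: coprimep_root Q_separable.
have [p [q ME]] := lax_commutant _ _ _ _ _ _ (chain_w0 0) sqfree com.
have [e1 e2 e3 e4] := transfer_orbit _ _ _ ME.
have [[f00 f01 f10 f11] [g00 g10 g11]] :=
  transfer_form _ s u w t m (lt0r_neq0 s_gt0) chain_tu chain_mw n.
rewrite -/(M n) ME !mxE /= in f00 f01 f10 f11 g00 g10 g11.
have h2 : 2 != 0 :> R by rewrite pnatr_eq0.
(* The trace of the transfer matrix recovers the degree of [p] and its value at 0. *)
have pp : 2 *: p = p + q * V + (p - q * V) by rewrite scaler_nat; ring.
have sp : size p = n.+1.
  rewrite -(size_scale p h2) pp addrC size_polyDl f11 // ltnS.
  by rewrite (maxn_idPl n0) in f00.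
have p_0 : p.[0] = 1.
  rewrite horner_coef0; apply: (mulfI h2).
  by rewrite -coefZ pp coefD g00 g11; ring.
have pq : p ^+ 2 - 1 = s ^+ 2 *: (Q * q ^+ 2).
  have := det_transfer R t m n; rewrite -/(M n) ME det_mx2 => D.
  rewrite -mul_polyC mulrA -lax_Q.
  by apply: (eq_of_sub_mul _ 1 _ _ _ _ D); ring.
(* The return map multiplies a nonzero coordinate column by this number and fixes it. *)
have pa : (- 1) ^+ n * p.[a^-1] = 1.
  case/orP: pos_vel1_neq0 => z0; apply: (mulIf z0).
    by rewrite -e1 Pn mul1r.
  by rewrite -e2 vn mul1r.
have pb : p.[b^-1] = 1.
  case/orP: pos_vel2_neq0 => z0; apply: (mulIf z0).
    by rewrite -e3 Pn mul1r.
  by rewrite -e4 vn mul1r.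
have a1 : a^-1 != 0 by rewrite invr_eq0 gt_eqF.
have b1 : b^-1 != 0 by rewrite invr_eq0 gt_eqF.
have c1 : beta^-1 != 0 by rewrite invr_eq0 gt_eqF.
have ab1 : a^-1 != b^-1 by rewrite (inj_eq invr_inj) gt_eqF.
have ac1 : a^-1 != beta^-1 by rewrite (inj_eq invr_inj).
have bc1 : b^-1 != beta^-1 by rewrite (inj_eq invr_inj).
have nev : ~~ odd n.
  apply/negP => nodd.
  rewrite -signr_odd nodd expr1 mulN1r in pa.
  apply: (pell_odd_false _ _ _ _ _ s2 a1 b1 c1 ab1 ac1 bc1 n p q) => //.
    by rewrite invr_gt0 ha ltf_pV2.
  by rewrite -pa opprK.
rewrite -signr_odd (negPf nev) expr0 mul1r in pa.
split=> //.
by apply: (pell_halve _ _ _ _ _ s2 a1 b1 c1 ab1 ac1 bc1 n p q).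
Qed.

Lemma pell_periodic n : (0 < n)%N -> ~~ odd n -> pell_condition a b beta n./2 ->
  n_periodic P v tau n.
Proof.
move=> n0 nev [p1 [q1 [sp1 sq1 pell]]].
apply/(return_mapP _ n0).
(* For [n = 2] the polynomial [q1] is zero, and [p1 ^+ 2 = 1] is impossible in degree 1. *)
have [k nE] : exists k, n = k.+2.*2.
  have nE : n = n./2.*2 by have := odd_double_half n; rewrite (negPf nev).
  case: (n./2) nE sp1 sq1 pell => [|[|k]] nE sp1 sq1 pell; first by rewrite nE in n0.
    move/eqP: sq1; rewrite size_poly_eq0 => /eqP q10.
    have p1n : p1 != 0 by rewrite -size_poly_gt0 sp1.
    move: pell; rewrite q10 expr0n mulr0 subr0 => pp.
    by have := size_mul p1n p1n; rewrite -expr2 pp size_poly1 sp1.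
  by exists k.
rewrite nE doubleK in sp1 sq1.
have [p [q [ME pr]]] := pell_transfer _ s u d w t m (lt0r_neq0 s_gt0) chain_u0 chain_w0
  chain_tu chain_mw chain_wS chain_dS chain_uS Q Q_monic size_Q Q_coef0 lax_Q k p1 q1 sp1 sq1 pell.
have [] := transfer_orbit _ _ _ ME.
rewrite !pr ?root_Q ?inE ?eqxx ?orbT // -nE -signr_odd (negPf nev) expr0 !mul1r.
by move=> e1 e2 e3 e4; rewrite [P _]surjective_pairing [v _]surjective_pairing
  e1 e2 e3 e4 -!surjective_pairing.
Qed.

End Trajectory.

(** * Equivalence of the two conditions, and the theorem *)

Lemma cayley_pell (R : realType) (a b beta : R) (k : nat) :
  0 < b -> b < a -> 0 < beta < b \/ b < beta < a -> (0 < k)%N ->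
  cayley_condition a b beta k <-> pell_condition a b beta k.
Proof.
move=> b0 ab hbeta k0.
have a0 : 0 < a by exact: lt_trans ab.
have beta0 : 0 < beta by case: hbeta => /andP[? ?] //; apply: lt_trans b0 _.
pose s := Num.sqrt (a * b * beta).
have s0 : s != 0 by rewrite gt_eqF // sqrtr_gt0 !mulr_gt0.
pose Q : {poly R} :=
  'X * ('X - (a^-1)%:P) * ('X - (b^-1)%:P) * ('X - (beta^-1)%:P).
pose g : {poly R} := (a%:P - 'X) * (b%:P - 'X) * (beta%:P - 'X).
(* Within this radius the three factors stay positive, so the radicand does not vanish. *)
pose e := Num.min (Num.min a b) beta.
have e0 : 0 < e by rewrite !lt_min a0 b0.
have gpos x : `|x| < e -> 0 < g.[x].
  rewrite !lt_min => /andP[/andP[xa xb] xc].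
  rewrite !(hornerM, hornerD, hornerN, hornerC, hornerX) !mulr_gt0 // subr_gt0.
  - exact: le_lt_trans (ler_norm _) xa.
  - exact: le_lt_trans (ler_norm _) xb.
  - exact: le_lt_trans (ler_norm _) xc.
have conv n : \sum_(i < n.+1) sqrt_coef a b beta i * sqrt_coef a b beta (n - i)%N = g`_n.
  rewrite -(taylor_coef_sqrt_conv _ _ _ e0 gpos) /sqrt_coef.
  have -> : (fun x => Num.sqrt g.[x]) =
            (fun x => Num.sqrt ((a - x) * (b - x) * (beta - x))).
    by apply/funext => x; rewrite !(hornerM, hornerD, hornerN, hornerC, hornerX).
  by [].
(* Each linear factor is reversed separately; the factor ['X] of [Q] becomes 1, which is why [g] has
   only three factors. *)
have gQ : g = s ^+ 2 *: rev_poly _ 4 Q.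
  have rev1 (c : R) : rev_poly _ 1 ('X - c%:P) = 1 - c%:P * 'X.
    by rewrite rev_polyB rev_polyC -(expr1 'X) rev_polyXn // expr0 expr1 mul_polyC.
  have X1 : (size ('X : {poly R}) <= 2)%N by rewrite size_polyX.
  have Xc (c : R) : (size ('X - c%:P)%R <= 2)%N by rewrite size_XsubC.
  rewrite /Q (rev_polyM _ 3 1) ?(size_polyM_leqD _ 2 1) ?(size_polyM_leqD _ 1 1) //.
  rewrite (rev_polyM _ 2 1) ?(size_polyM_leqD _ 1 1) // (rev_polyM _ 1 1) //.
  rewrite !rev1 -{1}(expr1 'X) rev_polyXn // subnn expr0 mul1r.
  have inv (x : R) : 0 < x -> x%:P - 'X = x%:P * (1 - (x^-1)%:P * 'X).
    by move=> x0; rewrite mulrBr mulr1 mulrA -polyCM mulfV ?mul1r // gt_eqF.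
  have -> : s ^+ 2 = a * b * beta by rewrite sqr_sqrtr // ltW // !mulr_gt0.
  by rewrite -mul_polyC /g !inv // !polyCM; ring.
have sQ : size Q = 5%N by exact: size_Q.
have Q0 : Q`_0 = 0 by exact: Q_coef0.
have Q1 : Q`_1 != 0 by exact: Q_coef1 hbeta.
(* For [k = 1] both sides fail: the empty determinant is 1, and [q = 0] leaves [p ^+ 2 = 1] with [p]
   of degree 1. *)
case: k k0 => [//|[|k]] _.
  rewrite /cayley_condition det_mx00; split=> [/eqP|]; first by rewrite oner_eq0.
  move=> [p [q [sp /eqP + pell]]]; rewrite size_poly_eq0 => /eqP q0.
  have p0 : p != 0 by rewrite -size_poly_gt0 sp.
  move: pell; rewrite q0 expr0n mulr0 subr0 => pp.
  by have := size_mul p0 p0; rewrite -expr2 pp size_poly1 sp.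
have sQ' : (size Q <= 5)%N by rewrite sQ.
split; first exact: hankel_pell _ _ g Q s s0 conv gQ sQ' Q0 Q1 k.
by move=> [p [q [sp sq pell]]]; exact: (pell_hankel _ _ g Q s s0 conv gQ sQ' Q1 k p q).
Qed.

Theorem corollary3p12 (R : realType) (a b beta : R)
    (P v : nat -> R * R) (tau : nat -> R) (n : nat)
    (hb : 0 < b) (hab : b < a)
    (hbeta : 0 < beta < b \/ b < beta < a)
    (htraj : magic_trajectory a b P v tau)
    (hcaustic : has_caustic a b P v beta)
    (hn : (0 < n)%N) :
  [/\ n_periodic P v tau n <-> ~~ odd n /\ cayley_condition a b beta n./2,
      n_periodic P v tau n <-> ~~ odd n /\ pell_condition a b beta n./2
    & ~~ odd n -> (cayley_condition a b beta n./2 <-> pell_condition a b beta n./2)].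
Proof.
have equiv : ~~ odd n -> cayley_condition a b beta n./2 <-> pell_condition a b beta n./2.
  move=> nev; apply: cayley_pell => //.
  by move: hn nev; case: n => [|[|]].
have pellP : n_periodic P v tau n <-> ~~ odd n /\ pell_condition a b beta n./2.
  split; first exact: periodic_pell hb hab hbeta htraj hcaustic n hn.
  by move=> [nev pell]; apply: pell_periodic hb hab hbeta htraj hcaustic n hn nev pell.
split=> //; rewrite pellP.
by split=> -[nev]; rewrite (equiv nev).
Qed.
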